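(* Let $f_j$ be nonnegative measurable functions on $\mathbb{R}^n$ vanishing at infinity. (i) If $A=(a_{ij})\in\mathrm{GL}_n(\mathbb{R})$, then $$\operatorname*{ess\,sup}_{y_1,\dots,y_n}\prod_{j=1}^{n}f_j^*\Big(\sum_{i=1}^{n}a_{ij}y_i\Big)\det(0,y_1,\dots,y_n)\le\operatorname*{ess\,sup}_{y_1,\dots,y_n}\prod_{j=1}^{n}f_j\Big(\sum_{i=1}^{n}a_{ij}y_i\Big)\det(0,y_1,\dots,y_n).$$ (ii) If $A=(a_{ij})\in\mathrm{GL}_{n+1}(\mathbb{R})$, then $$\operatorname*{ess\,sup}_{y_1,\dots,y_{n+1}}\prod_{j=1}^{n+1}f_j^*\Big(\sum_{i=1}^{n+1}a_{ij}y_i\Big)\det(y_1,\dots,y_{n+1})\le\operatorname*{ess\,sup}_{y_1,\dots,y_{n+1}}\prod_{j=1}^{n+1}f_j\Big(\sum_{i=1}^{n+1}a_{ij}y_i\Big)\det(y_1,\dots,y_{n+1}).$$ (All $y_i$ range over $\mathbb{R}^n$.) In particular, with $A=I$, $\operatorname{ess\,sup}\prod_{j=1}^n f_j^*(y_j)\det(0,y_1,\dots,y_n)\le\operatorname{ess\,sup}\prod_{j=1}^nf_j(y_j)\det(0,y_1,\dots,y_n)$ and similarly for $\det(y_1,\dots,y_{n+1})$.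
   Context: A nonnegative measurable function $f$ on $\mathbb{R}^n$ vanishes at infinity if $|\{x:f(x)>t\}|<\infty$ for every $t>0$. For a measurable set $A\subset\mathbb{R}^n$ of finite measure, $A^*$ is the open ball centred at $0$ with $|A^*|=|A|$; the symmetric decreasing rearrangement of $f$ is $f^*(x)=\int_0^\infty\chi_{\{f>t\}^*}(x)\,dt$. For $y_1,\dots,y_n\in\mathbb{R}^n$, $\det(0,y_1,\dots,y_n)=|\det M|$ with $M$ the matrix with columns $y_1,\dots,y_n$; for $y_1,\dots,y_{n+1}\in\mathbb{R}^n$, $\det(y_1,\dots,y_{n+1})$ is the absolute value of the determinant of the matrix with columns $y_1-y_{n+1},\dots,y_n-y_{n+1}$. ess sup denotes the essential supremum with respect to Lebesgue measure on the product space. *)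

(* Defs.v *)
From HB Require Import structures.
From mathcomp Require Import all_boot all_order all_algebra.
From mathcomp Require Import all_classical all_reals all_analysis.

Set Implicit Arguments.
Unset Strict Implicit.
Unset Printing Implicit Defensive.

Import Order.TTheory GRing.Theory Num.Theory.
Import numFieldNormedType.Exports.

Local Open Scope classical_set_scope.
Local Open Scope ring_scope.

(* The Euclidean space R^(p*q) is represented by 'M[R]_(p, q);
   in particular R^n is 'rV[R]_n = 'M[R]_(1, n), and the product space
   (R^n)^m of m-tuples (y_1,...,y_m) of points of R^n is 'M[R]_(m, n)
   (row i = y_i). *)

Section Lebesgue.
Variable R : realType.

Definition mbox p q (a b : 'M[R]_(p, q)) : set 'M[R]_(p, q) :=
  [set x | forall i j, a i j <= x i j <= b i j].

Definition mvol p q (a b : 'M[R]_(p, q)) : R :=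
  \prod_(i < p) \prod_(j < q) (b i j - a i j).

Definition lebesgue_outer p q (A : set 'M[R]_(p, q)) : \bar R :=
  ereal_inf [set s : \bar R | exists a b : nat -> 'M[R]_(p, q),
    [/\ (forall k i j, a k i j <= b k i j),
        A `<=` \bigcup_k mbox (a k) (b k) &
        s = (\sum_(0 <= k <oo) (mvol (a k) (b k))%:E)%E]].

Definition lmeasurable p q (A : set 'M[R]_(p, q)) : Prop :=
  forall X : set 'M[R]_(p, q),
    lebesgue_outer X = (lebesgue_outer (X `&` A) + lebesgue_outer (X `&` ~` A))%E.

Definition lmeasurable_fun p q (f : 'M[R]_(p, q) -> R) : Prop :=
  forall t : R, lmeasurable [set x | t < f x].

Definition suplevel p q (f : 'M[R]_(p, q) -> R) (t : R) : set 'M[R]_(p, q) :=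
  [set x | t < f x].

Definition vanishes_at_infinity n (f : 'rV[R]_n -> R) : Prop :=
  forall t : R, 0 < t -> (lebesgue_outer (suplevel f t) < +oo)%E.

Definition enorm n (x : 'rV[R]_n) : R := Num.sqrt (\sum_(i < n) x ord0 i ^+ 2).

Definition ball0 n (r : R) : set 'rV[R]_n := [set x | enorm x < r].

Definition sym_set n (A : set 'rV[R]_n) : set 'rV[R]_n :=
  [set x | exists r : R, lebesgue_outer (@ball0 n r) = lebesgue_outer A
                         /\ enorm x < r].

Definition sym_rearr n (f : 'rV[R]_n -> R) (x : 'rV[R]_n) : \bar R :=
  (\int[@lebesgue_measure R]_(t in `[0%R, +oo[%classic)
      (\1_(sym_set (suplevel f t)) x)%:E)%E.

Definition lebesgue_ess_sup p q (F : 'M[R]_(p, q) -> \bar R) : \bar R :=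
  ereal_inf [set c : \bar R | lebesgue_outer [set y | (c < F y)%E] = 0%E].

Definition det_origin n (y : 'M[R]_(n, n)) : R := `|\det y|.

Definition det_aff n (y : 'M[R]_(n.+1, n)) : R :=
  `|\det (\matrix_(i < n, k < n) (y (widen_ord (leqnSn n) i) k - y ord_max k))|.

End Lebesgue.

(* Main.v *)
Require Import Defs.
From HB Require Import structures.
From mathcomp Require Import all_boot all_order all_algebra.
From mathcomp Require Import all_classical all_reals all_analysis.
From mathcomp Require Import measurable_realfun ring lra.

Import Order.TTheory GRing.Theory Num.Theory.
Local Open Scope classical_set_scope.
Local Open Scope ring_scope.

Set Implicit Arguments.
Unset Strict Implicit.
Unset Printing Implicit Defensive.
Import numFieldNormedType.Exports.

                                   

(** Both inequalities concern [|\det (C *m Y)|] for a constant matrix [C]: the identity in (i), and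
    in (ii) the matrix that subtracts the last row from the others. Every essential upper bound [c]
    of the original product is shown to bound the rearranged product at every point
    ([ess_sup_sym_rearr]). If the rearrangements exceed t_j at the given points, these points lie in
    centred balls having the outer measure of level sets E_j = {f_j > s_j} with s_j >= t_j
    ([lt_sym_rearr]). Over the E_j the determinant is at most M = c / prod s_j off a null set, so it
    remains to carry a determinant bound from sets to balls of the same size ([det_le_of_null]).

    The almost everywhere bound becomes an everywhere bound on the essential supports [osupp (E j)],
    because a product of sets of positive outer measure has positive outer measure
    ([lebesgue_outer_rows]) and the change of variables by [A^T] keeps null sets null
    ([lebesgue_outer_mulmx0]). These supports are closed and contain E_j up to a null set. Cut off
    by a large ball and slightly thickened, they become bounded open sets V_j, at least as large as
    slightly smaller balls, at an arbitrarily small cost in M.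

    For the V_j the tool is Steiner symmetrization of all of them in one common direction u. It does
    not decrease volume, and it keeps the bound ([det_steiner]): with the parts orthogonal to u
    frozen, the determinant is linear in the components along u. No convergence of symmetrized sets
    is used. If the bound failed at a point of the balls B_j, it would fail on a box around it, so
    some V_j would miss its factor of the box; then V_j \ B_j and B_j \ V_j both have volume bounded
    below. Averaging over translations ([exists_shift]) yields a direction in which symmetrization
    raises the sum of vol(V_j & B_j) by a fixed amount ([vol_steiner_gain]). Repetition exceeds the
    finite total volume of the balls ([det_le_balls_contra]). *)

(** * Lebesgue measure on tuples and its translation invariance *)

Notation pt R n := (n.-tuple (measurableTypeR R)).

Definition tcons (R : realType) n (p : measurableTypeR R * pt R n) : pt R n.+1 :=
  [the n.+1.-tuple (measurableTypeR R) of p.1 :: p.2].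

Lemma measurable_tcons (R : realType) n : measurable_fun setT (@tcons R n).
Proof. exact: measurable_cons. Qed.

Section lebesgue_cons.
Context (R : realType) (n : nat) (m : {sigma_finite_measure set (pt R n) -> \bar R}).
Local Open Scope ereal_scope.

Definition lebesgue_cons : set (pt R n.+1) -> \bar R :=
  fun A => (@lebesgue_measure R \x m) (@tcons R n @^-1` A).

Let m0 : lebesgue_cons set0 = 0.
Proof. by rewrite /lebesgue_cons preimage_set0 measure0. Qed.

Let m_ge0 A : 0 <= lebesgue_cons A.
Proof. exact: measure_ge0. Qed.

Let m_sigma_additive : semi_sigma_additive lebesgue_cons.
Proof.
move=> F mF tF mUF; rewrite /lebesgue_cons preimage_bigcup.
apply: measure_semi_sigma_additive.
- by move=> k; rewrite -[X in measurable X]setTI; exact: measurable_tcons.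
- apply/trivIsetP => /= i j _ _ ij; rewrite -preimage_setI.
  by move/trivIsetP : tF => /(_ _ _ _ _ ij) ->//; rewrite preimage_set0.
- by rewrite -preimage_bigcup -[X in measurable X]setTI; exact: measurable_tcons.
Qed.

HB.instance Definition _ := isMeasure.Build _ _ _ lebesgue_cons
  m0 m_ge0 m_sigma_additive.

Let m_sigma_finite : sigma_finite setT lebesgue_cons.
Proof.
have /sigma_finiteP[F [TF ndF Foo]] := sigma_finiteT (@lebesgue_measure R).
have /sigma_finiteP[G [TG ndG Goo]] := sigma_finiteT m.
pose H k := [set x : pt R n.+1 | F k (thead x) /\ G k [tuple of behead x]].
have HE k : @tcons R n @^-1` H k = F k `*` G k.
  apply/seteqP; split => -[x y]; rewrite /H /tcons /= => -[Fx Gy]; split => //=.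
    by congr (G k _): Gy; exact/val_inj.
  by congr (G k _): Gy; exact/val_inj.
exists H.
  apply/esym; rewrite -subTset => x _.
  have : setT (thead x) by []. rewrite TF => -[i _ Fi].
  have : setT [tuple of behead x] by []. rewrite TG => -[j _ Gj].
  exists (maxn i j) => //; split.
  - by move: Fi; exact/subsetPset/ndF/leq_maxl.
  - by move: Gj; exact/subsetPset/ndG/leq_maxr.
move=> k; have [? ?] := Foo k; have [? ?] := Goo k; split.
  rewrite /H (_ : [set _ | _] = ((fun x : pt R n.+1 => thead x) @^-1` F k) `&`
    ((fun x : pt R n.+1 => [tuple of behead x]) @^-1` G k)) //.
  apply: measurableI; rewrite -[X in measurable X]setTI.
    exact: (@measurable_tnth _ _ _ ord0).
  exact: measurable_behead.
change (lebesgue_cons (H k) < +oo).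
rewrite /lebesgue_cons HE product_measure1E// lte_mul_pinfty// ge0_fin_numE//.
Qed.

HB.instance Definition _ := Measure_isSigmaFinite.Build _ _ _ lebesgue_cons
  m_sigma_finite.

Definition lebesgue_step : {sigma_finite_measure set (pt R n.+1) -> \bar R} :=
  lebesgue_cons.
End lebesgue_cons.

(** Built one coordinate at a time so that Tonelli splits off the first coordinate. The Dirac mass
    at the empty tuple gives R^0 measure 1. *)
Fixpoint leb (R : realType) n : {sigma_finite_measure set (pt R n) -> \bar R} :=
  match n return {sigma_finite_measure set (pt R n) -> \bar R} with
  | 0 => (\d_ ([tuple] : pt R 0))
  | k.+1 => lebesgue_step (leb R k)
  end.

Lemma lebS (R : realType) n (A : set (pt R n.+1)) :
  leb R n.+1 A = (@lebesgue_measure R \x leb R n)%E (@tcons R n @^-1` A).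
Proof. by []. Qed.

Lemma tcons0 (R : realType) n (p : measurableTypeR R * pt R n) :
  tnth (tcons p) ord0 = p.1.
Proof. exact: tnth0. Qed.

Lemma tconsS (R : realType) n (p : measurableTypeR R * pt R n) i :
  tnth (tcons p) (lift ord0 i) = tnth p.2 i.
Proof. exact: tnthS. Qed.

Lemma forall_ordS n (P : 'I_n.+1 -> Prop) :
  (forall i, P i) <-> P ord0 /\ forall i, P (lift ord0 i).
Proof.
split=> [h|[h0 hS] i]; first by split.
by case: (unliftP ord0 i) => [j ->|->].
Qed.

Lemma measurable_forall_tnth (R : realType) n (I : 'I_n -> set (measurableTypeR R)) :
  (forall i, measurable (I i)) ->
  measurable [set x : pt R n | forall i, I i (tnth x i)].
Proof.
move=> mI.
rewrite (_ : [set _ | _] = \bigcap_(i in [set: 'I_n])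
   ((fun x : pt R n => tnth x i) @^-1` I i)); last first.
  by apply/seteqP; split => [x xI i _|x xI i]; exact: xI.
apply: fin_bigcap_measurable => // i _.
by rewrite -[X in measurable X]setTI; exact: measurable_tnth.
Qed.

Lemma leb_forall_tnth (R : realType) n (I : 'I_n -> set (measurableTypeR R)) :
  (forall i, measurable (I i)) ->
  leb R n [set x | forall i, I i (tnth x i)]
  = (\prod_(i < n) lebesgue_measure (I i))%E.
Proof.
elim: n I => [|n IH] I mI.
  by rewrite big_ord0 /= diracE mem_set// => -[].
rewrite big_ord_recl lebS (_ : _ @^-1` _ =
  I ord0 `*` [set x | forall i, I (lift ord0 i) (tnth x i)]); last first.
  apply/seteqP; split => -[s x] /=; rewrite forall_ordS tcons0 => -[h0 h];
    split=> // i; by have := h i; rewrite tconsS.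
rewrite product_measure1E //.
  by rewrite (IH (fun i => I (lift ord0 i))).
by apply: (@measurable_forall_tnth _ _ (fun i => I (lift ord0 i))) => i; exact: mI.
Qed.

(** The pushforward under translation agrees with Lebesgue measure on half-open intervals, and these
    determine it. *)
Lemma lebesgue_measure_shift (R : realType) (a : R) (A : set (measurableTypeR R)) :
  measurable A -> lebesgue_measure [set s : R | A (a + s)] = lebesgue_measure A.
Proof.
move=> mA.
have mf : measurable_fun setT (fun s : measurableTypeR R => a + s : measurableTypeR R).
  exact: measurable_funD.
pose m := measure_function_pushforward__canonical__measure_function_Measure
  (@lebesgue_measure R) mf.
suff: lebesgue_measure A = m A by [].
apply: lebesgue_measure_unique => // _ [[x y]] _ <-.
rewrite /m /= /pushforward.
rewrite (_ : _ @^-1` _ = [set` `]x - a, y - a]]); last first.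
  apply/seteqP; split=> s /=; rewrite !in_itv/= => /andP[? ?];
   apply/andP; split; lra.
rewrite !lebesgue_measure_itv/= !lte_fin ltrD2r -!EFinD.
by case: ifP => // _; congr EFin; ring.
Qed.

Definition tadd (R : realType) n (a x : pt R n) : pt R n :=
  [tuple (tnth a i + tnth x i : R) | i < n].

Lemma measurable_tadd_fun (R : realType) d (T : measurableType d) n
    (f g : T -> pt R n) :
  measurable_fun setT f -> measurable_fun setT g ->
  measurable_fun setT (fun x => tadd (f x) (g x)).
Proof.
move=> /measurable_fun_tnthP mf /measurable_fun_tnthP mg.
apply/measurable_fun_tnthP => i.
rewrite (_ : _ \o _ = (fun x => tnth (f x) i + tnth (g x) i : R)); last first.
  by apply/funext => x /=; rewrite tnth_mktuple.
apply: measurable_funD; [exact: mf|exact: mg].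
Qed.

Lemma measurable_preimage d1 d2 (T1 : measurableType d1) (T2 : measurableType d2)
  (f : T1 -> T2) (A : set T2) : measurable_fun setT f -> measurable A ->
  measurable (f @^-1` A).
Proof. by move=> mf mA; rewrite -[X in measurable X]setTI; exact: mf. Qed.

Lemma tadd_tcons (R : realType) n (p q : measurableTypeR R * pt R n) :
  tadd (tcons p) (tcons q) = tcons (p.1 + q.1 : R, tadd p.2 q.2).
Proof.
apply: eq_from_tnth => i; rewrite tnth_mktuple.
case: (unliftP ord0 i) => [j ->|->]; first by rewrite !tconsS tnth_mktuple.
by rewrite !tcons0.
Qed.

Lemma tcons_eta (R : realType) n (x : pt R n.+1) :
  exists p, x = tcons p.
Proof.
exists (thead x, [tuple of behead x]).
by rewrite /tcons /= [LHS]tuple_eta; exact/val_inj.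
Qed.

(** By induction: sections at a fixed head absorb the shift of the tail, sections at a fixed tail
    absorb that of the head, and Tonelli passes from one order of integration to the other. *)
Lemma leb_shift (R : realType) n (a : pt R n) (A : set (pt R n)) :
  measurable A -> leb R n [set x | A (tadd a x)] = leb R n A.
Proof.
elim: n a A => [|n IH] a A mA.
  congr (leb R 0 _); apply/funext => x /=; congr (A _).
  by rewrite tuple0; apply/esym/tuple0.
have [[a0 a'] ->] := tcons_eta a.
have mT : measurable (@tcons R n @^-1` A).
  exact: measurable_preimage (@measurable_tcons R n) mA.
pose B : set (measurableTypeR R * pt R n) := [set p | A (tcons (a0 + p.1 : R, p.2))].
have mB : measurable B.
  apply: (@measurable_preimage _ _ _ _ (fun p : measurableTypeR R * pt R n =>
     tcons (a0 + p.1 : R, p.2) : pt R n.+1)) => //.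
  apply: measurable_cons; last exact: measurable_snd.
  by apply: (@measurable_funD _ _ _ _ (cst a0) fst); [exact: measurable_cst|exact: measurable_fst].
transitivity ((@lebesgue_measure R \x leb R n)%E B).
  rewrite lebS; apply: eq_integral => s _ /=.
  rewrite -[in RHS](IH a'); last exact: measurable_xsection.
  congr (leb R n _); apply/seteqP; split => x; rewrite /xsection /= !inE /B /=;
    by rewrite tadd_tcons.
rewrite lebS.
transitivity ((@lebesgue_measure R \x^ leb R n)%E B).
  apply: product_measure_unique => // X Y mX mY.
  exact: product_measure2E.
transitivity ((@lebesgue_measure R \x^ leb R n)%E (@tcons R n @^-1` A)); last first.
  apply/esym; apply: product_measure_unique => // X Y mX mY.
  exact: product_measure2E.
apply: eq_integral => x _ /=.
rewrite -[in RHS](lebesgue_measure_shift a0); last exact: measurable_ysection.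
by congr lebesgue_measure; apply/seteqP; split => s; rewrite /ysection /= !inE /B.
Qed.

(** * Volume of sets of row vectors; measurability of open sets *)

Definition rowt (R : realType) n (x : pt R n) : 'rV[R]_n := \row_i tnth x i.

(** Row vectors carry the topology and tuples the sigma-algebra; [rowt] transports one to the
    other. *)
Definition vol (R : realType) n (U : set 'rV[R]_n) : \bar R :=
  leb R n (@rowt R n @^-1` U).

Definition tscale (R : realType) n (s : R) (w : pt R n) : pt R n :=
  [tuple (s * tnth w i : R) | i < n].

Lemma open_mxP (R : realType) p q (U : set 'M[R]_(p, q)) :
  open U <-> forall x, U x -> exists2 e : R, 0 < e &
    forall y : 'M[R]_(p, q), (forall i j, `|x i j - y i j| < e) -> U y.
Proof.
rewrite openE; split => [oU x /oU|h x Ux].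
  move=> /nbhs_ballP[e e0 eU]; exists e => // y xy.
  by apply: eU; split.
have [e e0 eU] := h x Ux; apply/nbhs_ballP; exists e => // y [_ xy].
exact: eU.
Qed.

(** Cubes with rational data form a countable base. They give measurability of open sets and, later,
    the Lindelof argument of [outer_setD_osupp]. *)
Definition rbox (R : realType) n (p : n.-tuple rat * rat) : set 'rV[R]_n :=
  [set x | forall i, ball (ratr (tnth p.1 i) : R) (ratr p.2) (x ord0 i)].

Lemma measurable_rbox (R : realType) n (p : n.-tuple rat * rat) :
  measurable (@rowt R n @^-1` @rbox R n p).
Proof.
pose I i : set (measurableTypeR R) := ball (ratr (tnth p.1 i) : R) (ratr p.2).
rewrite (_ : _ @^-1` _ = [set x | forall i, I i (tnth x i)]).
  by apply: (@measurable_forall_tnth _ _ I) => i; exact: measurable_ball.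
by apply/seteqP; split => x h i; have := h i; rewrite mxE.
Qed.

Lemma near_rbox (R : realType) n (x : 'rV[R]_n) (e : R) : 0 < e ->
  exists p, @rbox R n p x /\ forall y, @rbox R n p y -> forall i j, `|x i j - y i j| < e.
Proof.
move=> e0.
have [k /andP[k0 ke]] : exists k : rat, (0 : R) < ratr k < e / 2.
  have /rat_in_itvoo[k] : (0 : R) < e / 2 by rewrite divr_gt0.
  by rewrite in_itv /= => h; exists k.
have hq i : exists q : rat, x ord0 i - ratr k < ratr q < x ord0 i + ratr k.
  have /rat_in_itvoo[q] : x ord0 i - ratr k < x ord0 i + ratr k by lra.
  by rewrite in_itv /= => h; exists q.
pose q := [tuple sval (cid (hq i)) | i < n].
have bx : @rbox R n (q, k) x.
  move=> i; rewrite /ball /= tnth_mktuple; case: cid => r /= /andP[? ?].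
  by rewrite ltr_norml; apply/andP; split; lra.
exists (q, k); split => // y by_ i j; rewrite (ord1 i).
have := bx j; have := by_ j; rewrite /ball /= !ltr_norml => /andP[? ?] /andP[? ?].
by apply/andP; split; lra.
Qed.

Lemma open_measurable_rowt (R : realType) n (U : set 'rV[R]_n) : open U ->
  measurable (@rowt R n @^-1` U).
Proof.
move=> /open_mxP oU.
pose F p := if pselect (@rbox R n p `<=` U) then @rbox R n p else set0.
rewrite (_ : U = \bigcup_p F p).
  rewrite preimage_bigcup; apply: countable_bigcupT_measurable; first exact: countableP.
  move=> p; rewrite /F; case: pselect => ? /=; first exact: measurable_rbox.
  by rewrite preimage_set0.
apply/seteqP; split => [x Ux|x [p _]]; last first.
  by rewrite /F; case: pselect => [h /= /h|? []].
have [e e0 eU] := oU _ Ux; have [p [px pe]] := near_rbox x e0.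
exists p => //; rewrite /F; case: pselect => [?|[]] //= y py.
by apply: eU; exact: pe.
Qed.

(** * Slicing along parallel lines, and overlaps of translates *)

Section lines.
Context (R : realType) (n : nat).
Implicit Types (A : set (pt R n.+1)) (w : pt R n).
Local Open Scope ereal_scope.

Let shear w (p : measurableTypeR R * pt R n) : pt R n.+1 :=
  tcons (p.1, tadd (tscale p.1 w) p.2).

Let measurable_shear w : measurable_fun setT (shear w).
Proof.
apply: measurable_cons; first exact: measurable_fst.
apply: measurable_tadd_fun; last exact: measurable_snd.
apply/measurable_fun_tnthP => i.
rewrite (_ : _ \o _ = (fun p : measurableTypeR R * pt R n => (p.1 : R) * tnth w i : R)%R).
  apply: (@measurable_funM _ _ _ _ fst (cst (tnth w i))).
    exact: measurable_fst.
  exact: measurable_cst.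
by apply/funext => p /=; rewrite tnth_mktuple.
Qed.

Let lineE w A z : [set s : measurableTypeR R | A (tcons (s, tadd (tscale s w) z))]
  = ysection (shear w @^-1` A) z.
Proof. by apply/seteqP; split => s; rewrite /ysection /= inE. Qed.

Lemma measurable_line w A z : measurable A ->
  measurable [set s : measurableTypeR R | A (tcons (s, tadd (tscale s w) z))].
Proof.
move=> mA; rewrite lineE; apply: measurable_ysection.
exact: measurable_preimage.
Qed.

Lemma measurable_fun_line w A : measurable A -> measurable_fun setT
  (fun z => lebesgue_measure
    [set s : measurableTypeR R | A (tcons (s, tadd (tscale s w) z))]).
Proof.
move=> mA; under eq_fun do rewrite lineE.
by apply: measurable_fun_ysection; exact: measurable_preimage.
Qed.

(** The shear (s, z) -> (s, s w + z) preserves measure, being a translation at each fixed s, and at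
    fixed z it runs through the line of direction (1, w). Directions are thus normalised to first
    coordinate 1, and sections are measured in the parameter s. *)
Lemma leb_lines w A : measurable A -> leb R n.+1 A =
  \int[leb R n]_z lebesgue_measure
    [set s : measurableTypeR R | A (tcons (s, tadd (tscale s w) z))].
Proof.
move=> mA.
have mB : measurable (shear w @^-1` A) by exact: measurable_preimage.
have mT : measurable (@tcons R n @^-1` A).
  exact: measurable_preimage (@measurable_tcons R n) mA.
transitivity ((@lebesgue_measure R \x leb R n) (shear w @^-1` A)).
  rewrite lebS; apply: eq_integral => s _ /=.
  rewrite -(leb_shift (tscale s w)); last exact: measurable_xsection.
  by congr (leb R n _); apply/seteqP; split => x; rewrite /xsection /= !inE.
transitivity ((@lebesgue_measure R \x^ leb R n) (shear w @^-1` A)).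
  apply: product_measure_unique => // X Y mX mY.
  exact: product_measure2E.
by apply: eq_integral => z _; rewrite lineE.
Qed.

End lines.

Section convolution.
Context (R : realType) (n : nat).
Implicit Types (P Q : set (pt R n)).
Local Open Scope ereal_scope.

Let pairs P Q : set (pt R n * pt R n) := [set p | P p.1 /\ Q (tadd p.1 p.2)].

Let measurable_pairs P Q : measurable P -> measurable Q -> measurable (pairs P Q).
Proof.
move=> mP mQ.
have : measurable ((fst : pt R n * pt R n -> pt R n) @^-1` P `&`
  (fun p : pt R n * pt R n => tadd p.1 p.2) @^-1` Q).
  by apply: measurableI; apply: measurable_preimage => //; exact: measurable_tadd_fun.
by [].
Qed.

Let convE P Q v : [set x | P x /\ Q (tadd x v)] = ysection (pairs P Q) v.
Proof. by apply/seteqP; split => s; rewrite /ysection /= inE. Qed.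

Lemma measurable_conv P Q v : measurable P -> measurable Q ->
  measurable [set x | P x /\ Q (tadd x v)].
Proof.
by move=> mP mQ; rewrite convE; apply: measurable_ysection; exact: measurable_pairs.
Qed.

Lemma measurable_fun_conv P Q : measurable P -> measurable Q ->
  measurable_fun setT (fun v => leb R n [set x | P x /\ Q (tadd x v)]).
Proof.
move=> mP mQ; under eq_fun do rewrite convE.
by apply: measurable_fun_ysection; exact: measurable_pairs.
Qed.

(** Tonelli on the pairs (x, v) with x in P and x + v in Q: at a fixed x in P the admissible v form
    a translate of Q. *)
Lemma leb_conv P Q : measurable P -> measurable Q -> leb R n P * leb R n Q =
  \int[leb R n]_v leb R n [set x | P x /\ Q (tadd x v)].
Proof.
move=> mP mQ; have mW := measurable_pairs mP mQ.
transitivity ((leb R n \x leb R n) (pairs P Q)).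
  transitivity (\int[leb R n]_x ((\1_P x)%:E * leb R n Q)).
    rewrite ge0_integralZr//; last exact/measurable_EFinP/measurable_indic.
    by rewrite integral_indic// setIT.
  apply: eq_integral => x _ /=; rewrite indicE.
  have [|] := boolP (x \in P); rewrite ?inE ?notin_setE => Px.
    rewrite mul1e -(leb_shift x mQ).
    by congr (leb R n _); apply/seteqP; split => v; rewrite /xsection /= ?inE => // -[].
  rewrite mul0e (_ : xsection _ _ = set0) ?measure0//.
  by apply/seteqP; split => v //; rewrite /xsection /= inE => -[].
transitivity ((leb R n \x^ leb R n) (pairs P Q)).
  apply: product_measure_unique => // X Y mX mY.
  exact: product_measure2E.
by apply: eq_integral => z _; rewrite convE.
Qed.

End convolution.

Lemma lebesgue_measure_itvcc (R : realType) (a b : R) : a <= b ->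
  lebesgue_measure (`[a, b]%classic : set (measurableTypeR R)) = (b - a)%:E.
Proof.
rewrite le_eqVlt => /predU1P[->|ab].
  by rewrite set_itv1 lebesgue_measure_set1 subrr.
by rewrite lebesgue_measure_itv /= lte_fin ab.
Qed.

Lemma leb_coord0 (R : realType) n : leb R n.+1 [set v | tnth v ord0 = 0 :> R] = 0%E.
Proof.
pose I (i : 'I_n.+1) : set (measurableTypeR R) := if i == ord0 then [set 0] else setT.
rewrite (_ : [set _ | _] = [set v | forall i, I i (tnth v i)]).
  rewrite leb_forall_tnth ?big_ord_recl /I /= ?lebesgue_measure_set1 ?mul0e//.
  by move=> i; case: ifP.
apply/seteqP; split => v /=; rewrite forall_ordS /I /=; last by case.
by move=> ->; split.
Qed.

                                                                                      
                                             
(** Averaging: the product of the volumes is the integral over v of the overlap of P with Q - v, and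
    the overlap vanishes outside a cube. Read contrapositively, it produces a translation with large
    overlap. Asking for a nonzero first coordinate costs only a null hyperplane and makes v a
    multiple of some (1, w), as slicing requires. *)
Lemma exists_shift (R : realType) n (P Q : set (pt R n.+1)) (K k : R) :
  measurable P -> measurable Q -> 0 <= K -> 0 <= k ->
  (forall x, P x -> forall i, `|tnth x i : R| <= K) ->
  (forall x, Q x -> forall i, `|tnth x i : R| <= K) ->
  (forall v, tnth v ord0 != 0 :> R ->
    (leb R n.+1 [set x | P x /\ Q (tadd x v)] <= k%:E)%E) ->
  (leb R n.+1 P * leb R n.+1 Q <= (k * (4 * K) ^+ n.+1)%:E)%E.
Proof.
move=> mP mQ K0 k0 PK QK h; rewrite leb_conv//.
(* Differences of points with coordinates at most [K] in absolute value have coordinates at most 2K,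
   so the cube has side 4K. *)
pose I : set (measurableTypeR R) := `[- (2 * K), 2 * K]%classic.
pose B : set (pt R n.+1) := [set v | forall i, I (tnth v i)].
have mB : measurable B.
  by apply: (@measurable_forall_tnth _ _ (fun=> I)) => i; exact: measurable_itv.
have lB : leb R n.+1 B = ((4 * K) ^+ n.+1)%:E.
  rewrite (@leb_forall_tnth _ _ (fun=> I)); last by move=> i; exact: measurable_itv.
  rewrite lebesgue_measure_itvcc; last by lra.
  rewrite prodEFin; congr EFin; rewrite prodr_const card_ord; congr (_ ^+ _); ring.
have -> : (k * (4 * K) ^+ n.+1)%:E = (\int[leb R n.+1]_v (k%:E * (\1_B v)%:E))%E.
  rewrite ge0_integralZl//; last exact/measurable_EFinP/measurable_indic.
  by rewrite integral_indic// setIT EFinM -lB.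
apply: ae_ge0_le_integral => //.
- exact: measurable_fun_conv.
- by move=> v _; rewrite mule_ge0.
- by apply: emeasurable_funM => //; exact/measurable_EFinP/measurable_indic.
exists [set v | tnth v ord0 = 0 :> R]; split.
- rewrite (_ : [set _ | _] = (fun v : pt R n.+1 => tnth v ord0) @^-1` [set 0])//.
  by apply: measurable_preimage; [exact: measurable_tnth|exact: measurable_set1].
- exact: leb_coord0.
move=> v /= hv; apply/eqP; apply: contra_notT hv => v0 _.
rewrite indicE; have [|] := boolP (v \in B); rewrite ?inE ?notin_setE => Bv.
  by rewrite mule1; exact: h.
rewrite mule0 (_ : [set _ | _] = set0) ?measure0//.
apply/seteqP; split => // x [Px Qx]; apply: Bv => i.
have := PK _ Px i; have := QK _ Qx i; rewrite /I tnth_mktuple !ler_norml /= in_itv /=.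
move=> /andP[? ?] /andP[? ?]; apply/andP; split; lra.
Qed.

                                                                      

(** * Outer measure: countable subadditivity and covers by open boxes *)

Lemma nneseries_nneseries (R : realType) : exists f : nat -> nat * nat,
  (forall p, exists i, f i = p) /\
  forall g : nat -> nat -> \bar R, (forall k j, 0 <= g k j)%E ->
  (\sum_(0 <= i <oo) g (f i).1 (f i).2 =
   \sum_(0 <= k <oo) \sum_(0 <= j <oo) g k j)%E.
Proof.
have /card_esym/card_set_bijP[f [_ inj_f surj_f]] := card_nat2.
exists f; split=> [p|g g0]; first by have [i _ fi] := surj_f p Logic.I; exists i.
have gE k : (\sum_(0 <= j <oo) g k j = \esum_(j in [set: nat]) g k j)%E.
  by rewrite nneseries_esumT.
under [RHS]eq_eseriesr do rewrite gE.
rewrite [RHS]nneseries_esumT; last by move=> k; exact: esum_ge0.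
rewrite esum_esum// nneseries_esumT//.
apply/esym; apply: (@reindex_esum _ _ _ _ _ f (fun p => g p.1 p.2)); split => //.
by move=> p _; exact: surj_f.
Qed.

Section outer.
Context (R : realType) (p q : nat).
Implicit Types (A B : set 'M[R]_(p, q)) (a b : 'M[R]_(p, q)).
Local Notation lo := (@lebesgue_outer R p q).

Lemma mvol_ge0 a b : (forall i j, a i j <= b i j) -> 0 <= mvol a b.
Proof.
by move=> ab; apply: prodr_ge0 => i _; apply: prodr_ge0 => j _; rewrite subr_ge0.
Qed.

Lemma lebesgue_outer_ge0 A : (0 <= lo A)%E.
Proof.
apply: le_ereal_inf_tmp => _ [a [b [ab _ ->]]].
by apply: nneseries_ge0 => k _ _; rewrite lee_fin mvol_ge0.
Qed.

Lemma le_lebesgue_outer A B : A `<=` B -> (lo A <= lo B)%E.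
Proof.
move=> AB; apply: ereal_inf_le_tmp => _ [a [b [ab Bab ->]]].
by exists a, b; split=> //; exact: subset_trans Bab.
Qed.

Lemma lebesgue_outer_null_sub A B : A `<=` B -> lo B = 0%E -> lo A = 0%E.
Proof.
move=> AB B0; apply/eqP; rewrite eq_le lebesgue_outer_ge0 andbT -B0.
exact: le_lebesgue_outer.
Qed.

(** Covers of the A_n within e / 2^(n+1) of optimal are merged by enumerating pairs; a member of
    infinite outer measure makes the bound trivial. *)
Lemma lebesgue_outer_bigcup (A : nat -> set 'M[R]_(p, q)) :
  (lo (\bigcup_k A k) <= \sum_(0 <= k <oo) lo (A k))%E.
Proof.
have [[i ioo]|] := pselect (exists i, lo (A i) = +oo%E).
  rewrite (eseries_pinfty _ _ ioo) ?leey// => n _.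
  by rewrite -ltNye (lt_le_trans _ (lebesgue_outer_ge0 _)).
rewrite -forallNE => Aoo.
apply/lee_addgt0Pr => e e0.
rewrite (le_trans _ (epsilon_trick _ _ _))//; last 2 first.
- by move=> n; exact: lebesgue_outer_ge0.
- exact: ltW.
pose P n (ab : (nat -> 'M[R]_(p, q)) * (nat -> 'M[R]_(p, q))) :=
  [/\ (forall k i j, ab.1 k i j <= ab.2 k i j),
      A n `<=` \bigcup_k mbox (ab.1 k) (ab.2 k) &
   (\sum_(0 <= k <oo) (mvol (ab.1 k) (ab.2 k))%:E <= lo (A n) + (e / (2 ^ n.+1)%:R)%:E)%E].
have [G PG] : {G & forall n, P n (G n)}.
  apply: (@choice _ _ P) => n.
  have fin : lo (A n) \is a fin_num.
    rewrite ge0_fin_numE ?lebesgue_outer_ge0// ltey; exact/eqP/Aoo.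
  have en : 0 < e / (2 ^ n.+1)%:R by rewrite divr_gt0// ltr0n expn_gt0.
  have [x [a [b [ab Aab ->]]] xS] := lb_ereal_inf_adherent en fin.
  by exists (a, b); split => //; exact: ltW.
have [f [surj_f fE]] := nneseries_nneseries R.
pose g k j : \bar R := (mvol ((G k).1 j) ((G k).2 j))%:E.
have g0 k j : (0 <= g k j)%E by rewrite lee_fin mvol_ge0//; have [] := PG k.
apply: (@le_trans _ _ (\sum_(0 <= k <oo) \sum_(0 <= j <oo) g k j)%E); last first.
  apply: lee_nneseries => [k _ _|k _]; first exact: nneseries_ge0.
  by have [] := PG k.
rewrite -fE//; apply: ereal_inf_lbound => /=.
exists (fun i => (G (f i).1).1 (f i).2), (fun i => (G (f i).1).2 (f i).2); split => //.
  by move=> k; have [] := PG (f k).1.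
move=> x [n _ Anx]; have [_ + _] := PG n; move=> /(_ _ Anx)[k _ xk].
by have [i fi] := surj_f (n, k); exists i; rewrite // fi.
Qed.

Lemma lebesgue_outer_bigcup0 (A : nat -> set 'M[R]_(p, q)) :
  (forall k, lo (A k) = 0%E) -> lo (\bigcup_k A k) = 0%E.
Proof.
move=> A0; apply/eqP; rewrite eq_le lebesgue_outer_ge0 andbT.
by rewrite (le_trans (lebesgue_outer_bigcup _))// eseries0.
Qed.

(** Degenerate boxes pad a finite cover to an infinite sequence. In dimension zero the empty product
    gives every box volume 1, hence the positivity conditions here and below. *)
Lemma mvol0 a : (0 < p)%N -> (0 < q)%N -> mvol a a = 0.
Proof.
move=> p0 q0; apply/eqP/prodf_eq0; exists (Ordinal p0) => //.
by apply/prodf_eq0; exists (Ordinal q0) => //; rewrite subrr.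
Qed.

Lemma lebesgue_outer_box a b A : (0 < p)%N -> (0 < q)%N ->
  (forall i j, a i j <= b i j) -> A `<=` mbox a b -> (lo A <= (mvol a b)%:E)%E.
Proof.
move=> p0 q0 ab Aab; apply: ereal_inf_lbound => /=.
exists (fun=> a), (fun k => if k is 0 then b else a); split.
- by case.
- by move=> x /Aab xab; exists 0%N.
rewrite nneseries_recl//; last by case=> [|k] _; rewrite lee_fin mvol_ge0.
rewrite eseries0 ?adde0// => -[//|k _ _].
by rewrite mvol0.
Qed.

Lemma lebesgue_outer0 : (0 < p)%N -> (0 < q)%N -> lo set0 = 0%E.
Proof.
move=> p0 q0; apply/eqP; rewrite eq_le lebesgue_outer_ge0 andbT.
have -> : 0%E = (mvol (0 : 'M[R]_(p, q)) 0)%:E by rewrite mvol0.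
exact: lebesgue_outer_box.
Qed.

Lemma mvol_enlarge a b (e : R) : 0 < e -> (forall i j, a i j <= b i j) ->
  exists2 d, 0 < d &
    mvol (\matrix_(i, j) (a i j - d)) (\matrix_(i, j) (b i j + d)) <= mvol a b + e.
Proof.
move=> e0 ab.
(* The volume of the box enlarged by d is a polynomial in d, so its continuity at 0 provides d. *)
pose P : {poly R} := \prod_(i < p) \prod_(j < q) ((b i j - a i j)%:P + 2%:P * 'X).
have PE d : P.[d] = mvol (\matrix_(i, j) (a i j - d)) (\matrix_(i, j) (b i j + d)).
  rewrite /P horner_prod; apply: eq_bigr => i _; rewrite horner_prod.
  by apply: eq_bigr => j _; rewrite !hornerE !mxE; ring.
have P0 : P.[0] = mvol a b.
  rewrite PE; apply: eq_bigr => i _; apply: eq_bigr => j _.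
  by rewrite !mxE subr0 addr0.
have /cvgrPdist_lt/(_ e e0) := @continuous_horner R P 0.
move=> /nbhs_ballP[d /= d0 dP]; exists (d / 2); first exact: divr_gt0.
rewrite -PE -P0.
have : `|P.[0] - P.[d / 2]| < e.
  apply: dP; rewrite /ball /= sub0r normrN gtr0_norm ?divr_gt0//; lra.
by rewrite ltr_norml => /andP[? ?]; lra.
Qed.

                                                                             
(** The slack in the strict inequality pays for enlarging the k-th box at cost e / 2^(k+1). Open
    boxes are what lets [lebesgue_outer_mulmx0] and [lebesgue_outer_stack] pass from covers to open
    sets. *)
Lemma lebesgue_outer_open_cover A (s : \bar R) : (lo A < s)%E ->
  exists a b : nat -> 'M[R]_(p, q),
  [/\ forall k i j, a k i j < b k i j,
      A `<=` \bigcup_k [set x | forall i j, a k i j < x i j < b k i j] &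
      (\sum_(0 <= k <oo) (mvol (a k) (b k))%:E < s)%E].
Proof.
move=> /ereal_inf_lt[_ [a [b [ab Aab ->]]]].
set S := (\sum_(0 <= k <oo) _)%E => Ss.
have S0 : (0 <= S)%E by apply: nneseries_ge0 => k _ _; rewrite lee_fin mvol_ge0.
have [e e0 eS] : exists2 e, 0 < e & (S + e%:E < s)%E.
  have : S \is a fin_num by rewrite ge0_fin_numE// (lt_le_trans Ss)// leey.
  move: Ss => /[swap] /fineK <-; case: s => [s| |] //.
    rewrite lte_fin => h; exists ((s - fine S) / 2); first lra.
    by rewrite -EFinD lte_fin; lra.
  by move=> _; exists 1 => //; rewrite -EFinD ltry.
have en n : 0 < e / (2 ^ n.+1)%:R by rewrite divr_gt0// ltr0n expn_gt0.
have [d dP] : {d : nat -> R & forall n, 0 < d n /\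
    mvol (\matrix_(i, j) (a n i j - d n)) (\matrix_(i, j) (b n i j + d n))
     <= mvol (a n) (b n) + e / (2 ^ n.+1)%:R}.
  apply: (@choice _ _ (fun n d => 0 < d /\
    mvol (\matrix_(i, j) (a n i j - d)) (\matrix_(i, j) (b n i j + d))
     <= mvol (a n) (b n) + e / (2 ^ n.+1)%:R)) => n.
  by have [d d0 h] := mvol_enlarge (en n) (ab n); exists d.
exists (fun n => \matrix_(i, j) (a n i j - d n)), (fun n => \matrix_(i, j) (b n i j + d n)).
split => [k i j|x /Aab[k _ xk]|].
- by rewrite !mxE; have [? _] := dP k; have := ab k i j; lra.
- exists k => // i j; rewrite !mxE; have [? _] := dP k.
  by have /andP[? ?] := xk i j; apply/andP; split; lra.
apply: le_lt_trans eS; apply: le_trans (epsilon_trick _ _ _); last 2 first.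
- by move=> n; rewrite lee_fin mvol_ge0.
- exact: ltW.
apply: lee_nneseries => [k _ _|k _].
  rewrite lee_fin mvol_ge0// => i j; rewrite !mxE; have [? _] := dP k.
  by have := ab k i j; lra.
by rewrite -EFinD lee_fin; have [] := dP k.
Qed.

End outer.

(** * Outer measure against product measure; Lipschitz images and linear images of null sets *)

Section outer_vs_leb.
Context (R : realType) (p q N : nat) (psi : 'I_p -> 'I_q -> 'I_N).
Hypothesis psi_bij : bijective (fun ij : 'I_p * 'I_q => psi ij.1 ij.2).

(** The labelling [psi] of entries by coordinates lets one comparison serve row vectors
    ([row_index]) and flattened matrices ([mxvec_index]). *)
Definition tmx (t : pt R N) : 'M[R]_(p, q) := \matrix_(i, j) tnth t (psi i j).

Lemma leb_tmx_mbox (a b : 'M[R]_(p, q)) : (forall i j, a i j <= b i j) ->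
  measurable [set t | mbox a b (tmx t)] /\
  leb R N [set t | mbox a b (tmx t)] = (mvol a b)%:E.
Proof.
move=> ab; have [g gK Kg] := psi_bij.
pose I k : set (measurableTypeR R) := `[a (g k).1 (g k).2, b (g k).1 (g k).2]%classic.
have -> : [set t | mbox a b (tmx t)] = [set t | forall k, I k (tnth t k)].
  apply/seteqP; split => [t tab k|t tI i j].
    have := tab (g k).1 (g k).2; rewrite mxE.
    by have /= -> := Kg k; rewrite /I /= in_itv.
  by have := tI (psi i j); rewrite mxE /I (gK (i, j)) /= in_itv.
have mI k : measurable (I k) by exact: measurable_itv.
split; first exact: measurable_forall_tnth.
rewrite leb_forall_tnth//.
under eq_bigr do rewrite lebesgue_measure_itvcc//.
rewrite prodEFin; congr EFin; rewrite /mvol pair_bigA /=.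
rewrite (reindex (fun ij : 'I_p * 'I_q => psi ij.1 ij.2)) /=; last exact: onW_bij.
by apply: eq_bigr => -[i j] _; rewrite (gK (i, j)).
Qed.

Lemma leb_le_outer (A : set 'M[R]_(p, q)) : measurable [set t | A (tmx t)] ->
  (leb R N [set t | A (tmx t)] <= lebesgue_outer A)%E.
Proof.
move=> mA; apply: le_ereal_inf_tmp => _ [a [b [ab Aab ->]]].
under eq_eseriesr do rewrite -(leb_tmx_mbox (ab _)).2.
apply: (measure_sigma_subadditive (leb R N)) => //.
  by move=> k; exact: (leb_tmx_mbox (ab k)).1.
by move=> t /Aab[k _ ?]; exists k.
Qed.

End outer_vs_leb.

(** Dyadic cells are nested: the cell at level k + d determines the cell at level k. *)
Lemma floor_pow2 (R : realType) (k d : nat) (x y : R) :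
  Num.floor (2 ^+ (k + d) * x) = Num.floor (2 ^+ (k + d) * y) ->
  Num.floor (2 ^+ k * x) = Num.floor (2 ^+ k * y).
Proof.
move=> xy; apply/esym/floor_def.
have /andP[mx xm] := floor_itv (2 ^+ k * x).
set m := Num.floor (2 ^+ k * x) in mx xm *.
have e0 : 0 < 2 ^+ d :> R by rewrite exprn_gt0.
have E (z : R) : 2 ^+ (k + d) * z = 2 ^+ k * z * 2 ^+ d by rewrite exprD; ring.
have H (n : int) : (n * 2 ^+ d)%:~R = n%:~R * 2 ^+ d :> R by rewrite intrM rmorphXn.
have := mx; rewrite -(ler_pM2r e0) -H -E -floor_ge_int xy floor_ge_int E H ler_pM2r// => ->.
by have := xm; rewrite -(ltr_pM2r e0) -H -E -floor_lt_int xy floor_lt_int E H ltr_pM2r.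
Qed.

Section lipschitz.
Context (R : realType) (p q : nat).
Hypotheses (p_gt0 : (0 < p)%N) (q_gt0 : (0 < q)%N).
Local Notation N := (p * q)%N.
Variables (T : 'rV[R]_N -> 'M[R]_(p, q)) (K : R).
Hypothesis K_ge0 : 0 <= K.
Hypothesis T_lip : forall (x y : 'rV[R]_N) d, (forall k, `|x ord0 k - y ord0 k| <= d) ->
  forall i j, `|T x i j - T y i j| <= K * d.

Let dfloor k (x : 'rV[R]_N) i : int := Num.floor (2 ^+ k * x ord0 i).

Let cube k x : set 'rV[R]_N := [set y | forall i, dfloor k y i = dfloor k x i].

                                                                          
(** The dyadic cube of level [kc.1] and label [kc.2] if it lies in U and no coarser cube around it
    (down to level 0) does; empty otherwise. These maximal cubes partition an open U. *)
Let piece (U : set 'rV[R]_N) (kc : nat * N.-tuple int) : set 'rV[R]_N :=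
  [set x | [/\ forall i, dfloor kc.1 x i = tnth kc.2 i, cube kc.1 x `<=` U &
    forall k, (k < kc.1)%N -> ~ cube k x `<=` U]].

Let cube_le k d x y : cube (k + d) x y -> cube k x = cube k y.
Proof.
move=> xy; apply/seteqP; split => z xz i; have := xz i;
  by have := floor_pow2 (xy i) => h ->; rewrite /dfloor h.
Qed.

Let piece_cube U kc x : piece U kc x ->
  piece U kc = [set y | forall i, dfloor kc.1 y i = tnth kc.2 i].
Proof.
case: kc => k c [/= xc xU xk]; apply/seteqP; split => [y []//|y /= yc].
have xy : cube (k + 0) x y by move=> i; rewrite addn0 yc xc.
have cxy : cube k x = cube k y by exact: cube_le xy.
split => //=; first by rewrite -cxy.
move=> j jk; rewrite -(@cube_le j (k - j) x y); first exact: xk.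
by rewrite subnKC ?(ltnW jk)//; rewrite addn0 in xy.
Qed.

Let leb_cube k (c : N.-tuple int) :
  measurable (@rowt R N @^-1` [set y | forall i, dfloor k y i = tnth c i]) /\
  vol [set y : 'rV[R]_N | forall i, dfloor k y i = tnth c i] = ((2 ^+ k)^-1 ^+ N)%:E.
Proof.
have e0 : 0 < 2 ^+ k :> R by rewrite exprn_gt0.
pose I i : set (measurableTypeR R) :=
  `[(tnth c i)%:~R / 2 ^+ k, (tnth c i + 1)%:~R / 2 ^+ k[%classic.
have IE : @rowt R N @^-1` [set y | forall i, dfloor k y i = tnth c i]
    = [set t | forall i, I i (tnth t i)].
  apply/seteqP; split => t /= h i; have := h i; rewrite /dfloor mxE /I /= in_itv /=
    ler_pdivrMr// ltr_pdivlMr// (mulrC (tnth t i : R)).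
    by move/eqP; rewrite floor_eq.
  by rewrite -floor_eq => /eqP.
have mI i : measurable (I i) by exact: measurable_itv.
rewrite /vol IE; split; first exact: measurable_forall_tnth.
rewrite leb_forall_tnth// (eq_bigr (fun=> ((2 ^+ k)^-1)%:E)); last first.
  move=> i _; rewrite lebesgue_measure_itv /= lte_fin ltr_pM2r ?invr_gt0//.
  by rewrite ltr_int ltzD1 lexx -EFinB -mulrBl -intrB addrAC subrr add0r mul1r.
by rewrite prodEFin prodr_const card_ord.
Qed.

Let outer_piece U kc : measurable (@rowt R N @^-1` piece U kc) /\
  (lebesgue_outer (T @` piece U kc) <= (K ^+ N)%:E * vol (piece U kc))%E.
Proof.
have [->|/set0P[x xU]] := eqVneq (piece U kc) set0.
  split; first by rewrite preimage_set0.
  by rewrite image_set0 lebesgue_outer0// mule_ge0// lee_fin exprn_ge0.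
rewrite (piece_cube xU); case: kc xU => k c _ /=; split; first exact: (leb_cube k c).1.
rewrite (leb_cube k c).2 -EFinM -exprMn.
have e0 : 0 < 2 ^+ k :> R by rewrite exprn_gt0.
(* [z] is the centre of the cube, and [h] the half-side of a box around [T z] containing the
   image. *)
pose z : 'rV[R]_N := \row_i (((tnth c i)%:~R + 1 / 2) / 2 ^+ k).
pose h := K * (1 / 2 / 2 ^+ k).
have hE (y : R) : y + h - (y - h) = K / 2 ^+ k.
  by rewrite opprB addrC addrA subrK -mulrDr -mulrDl (_ : 1 / 2 + 1 / 2 = 1) ?mul1r//; lra.
have h0 : 0 <= h by rewrite mulr_ge0// divr_ge0// ltW.
apply: le_trans (lebesgue_outer_box
  (a := \matrix_(i, j) (T z i j - h)) (b := \matrix_(i, j) (T z i j + h)) _ _ _ _) _ => //.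
- by move=> i j; rewrite !mxE; lra.
- move=> _ [y yc <-] i j; rewrite !mxE.
  suff : `|T y i j - T z i j| <= h by rewrite ler_norml => /andP[? ?]; apply/andP; split; lra.
  apply: T_lip => l; rewrite mxE.
  have /eqP := yc l; rewrite floor_eq => /andP[]; rewrite intrD mulr1z => h1 h2.
  have -> : y ord0 l - ((tnth c l)%:~R + 1 / 2) / 2 ^+ k =
     (2 ^+ k * y ord0 l - ((tnth c l)%:~R + 1 / 2)) / 2 ^+ k.
    by rewrite mulrBl [2 ^+ k * _]mulrC mulfK ?gt_eqF.
  rewrite normrM (@ger0_norm _ (2 ^+ k)^-1) ?invr_ge0 ?(ltW e0)//.
  rewrite ler_pM2r ?invr_gt0// ler_norml.
  by apply/andP; split; lra.
rewrite lee_fin /mvol le_eqVlt; apply/orP; left; apply/eqP.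
under eq_bigr => i _ do under eq_bigr => j _ do
  rewrite !mxE hE.
by rewrite prodr_const prodr_const !card_ord -exprM mulnC.
Qed.

(** An open set is a disjoint union of maximal dyadic cubes, and the image of a cube of side 2^-k
    lies in a box of side K 2^-k, whose volume is K^N times that of the cube. *)
Lemma lebesgue_outer_lipschitz (U : set 'rV[R]_N) : open U ->
  (lebesgue_outer (T @` U) <= (K ^+ N)%:E * vol U)%E.
Proof.
move=> /open_mxP oU.
(* [pickle_inv] decodes each pair from exactly one index, so no piece is counted twice. *)
pose S m : set 'rV[R]_N := if pickle_inv m is Some kc then piece U kc else set0.
have SU : U = \bigcup_m S m.
  apply/seteqP; split => [x Ux|x [m _]]; last first.
    by rewrite /S; case: pickle_inv => // kc [_ + _]; exact.
  have [e e0 eU] := oU _ Ux.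
  have ex : exists k, `[< cube k x `<=` U >].
    have [n ne] : exists n, 1 / 2 ^+ n < e.
      have [n _ /(_ n)] := near_infty_natSinv_expn_lt (PosNum e0).
      by move=> h; exists n; apply: h => /=.
    exists n; apply/asboolP => y xy; apply: eU => i j.
    have n0 : 0 < 2 ^+ n :> R by rewrite exprn_gt0.
    apply: le_lt_trans ne; rewrite ler_pdivlMr// -(gtr0_norm n0) -normrM.
    have /eqP := xy j; rewrite floor_eq /dfloor.
    have := floor_itv (2 ^+ n * x ord0 j); set m := Num.floor _.
    rewrite intrD mulr1z !ord1 => /andP[? ?] /andP[? ?].
    by rewrite ler_norml; apply/andP; split; lra.
  case: (ex_minnP ex) => k /asboolP kU kmin.
  exists (pickle (k, [tuple dfloor k x i | i < N])) => //.
  rewrite /S pickleK_inv; split => //= [i|j jk /asboolP /kmin].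
    by rewrite tnth_mktuple.
  by rewrite leqNgt jk.
have mS m : measurable (@rowt R N @^-1` S m).
  by rewrite /S; case: pickle_inv => [kc|]; [exact: (outer_piece U kc).1|rewrite preimage_set0].
have tS : trivIset setT (fun m => @rowt R N @^-1` S m).
  apply/trivIsetP => m n _ _; apply: contra_neqP => /eqP/set0P[t []].
  rewrite /preimage /S /=.
  case Em : (pickle_inv m) => [[k c]|//] [/= tc tU tk].
  case En : (pickle_inv n) => [[l d]|//] [/= td tU' tl].
  have kl : k = l.
    by have [lk|kl|//] := ltngtP k l; [case: (tl _ lk tU)|case: (tk _ kl tU')].
  have cd : c = d.
    by apply: eq_from_tnth => i; rewrite -tc -td kl.
  have := @pickle_invK (nat * N.-tuple int)%type m.
  have := @pickle_invK (nat * N.-tuple int)%type n.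
  by rewrite Em En /= kl cd => -> ->.
have volU : vol U = (\sum_(0 <= m <oo) vol (S m))%E.
  rewrite [in LHS]SU /vol preimage_bigcup measure_semi_bigcup//.
  by apply: bigcup_measurable => m _; exact: mS.
rewrite volU -nneseriesZl; last by move=> m _; exact: measure_ge0.
rewrite [in X in (X <= _)%E]SU image_bigcup.
apply: le_trans (lebesgue_outer_bigcup _) _.
apply: lee_nneseries => [m _ _|m _]; first exact: lebesgue_outer_ge0.
rewrite /S; case: pickle_inv => [kc|]; first exact: (outer_piece U kc).2.
by rewrite image_set0 lebesgue_outer0// mule_ge0// lee_fin exprn_ge0.
Qed.

End lipschitz.

Definition obox (R : realType) p q (a b : 'M[R]_(p, q)) : set 'M[R]_(p, q) :=
  [set x | forall i j, a i j < x i j < b i j].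

Lemma obox_mbox (R : realType) p q (a b : 'M[R]_(p, q)) : obox a b `<=` mbox a b.
Proof. by move=> x xab i j; have /andP[/ltW-> /ltW->] := xab i j. Qed.

Lemma open_obox (R : realType) p q (a b : 'M[R]_(p, q)) : open (obox a b).
Proof.
rewrite openE => x xab; exists (fun i j => [set z | a i j < z < b i j]) => // i j.
have := near_in_itvoo (xab i j); apply: filterS => z.
by rewrite in_itv.
Qed.

Definition row_index n (i : 'I_1) (j : 'I_n) : 'I_n := j.

Lemma row_index_bij n : bijective (fun ij : 'I_1 * 'I_n => row_index ij.1 ij.2).
Proof. by exists (fun j => (ord0, j)) => [[i j]|//]; rewrite (ord1 i). Qed.

Lemma mxvec_index_bij p q :
  bijective (fun ij : 'I_p * 'I_q => mxvec_index ij.1 ij.2).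
Proof.
have [g gK Kg] := onT_bij (curry_mxvec_bij p q).
by exists g => [[i j]|k]; [exact: (gK (i, j))|have := Kg k; case: (g k)].
Qed.

Lemma vol_mbox (R : realType) n (a b : 'rV[R]_n) :
  (forall i j, a i j <= b i j) -> vol (mbox a b) = (mvol a b)%:E.
Proof. by move=> ab; have [] := leb_tmx_mbox (row_index_bij n) ab. Qed.

Lemma vol_le_outer (R : realType) n (A : set 'rV[R]_n) :
  measurable (@rowt R n @^-1` A) -> (vol A <= lebesgue_outer A)%E.
Proof. exact: (leb_le_outer (row_index_bij n)). Qed.

Lemma outer_le_vol (R : realType) n (U : set 'rV[R]_n) : (0 < n)%N -> open U ->
  (lebesgue_outer U <= vol U)%E.
Proof.
move=> n0.
(* The Lipschitz estimate, applied to the identity, speaks of vectors of length [1 * n]; abstracting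
   the length [N] allows the rewriting to [n]. *)
suff H p q N (T : 'rV[R]_N -> 'M[R]_(p, q)) : (0 < p)%N -> (0 < q)%N -> N = (p * q)%N ->
    (forall (x y : 'rV[R]_N) d, (forall k, `|x ord0 k - y ord0 k| <= d) ->
      forall i j, `|T x i j - T y i j| <= 1 * d) ->
    forall V, open V -> (lebesgue_outer (T @` V) <= vol V)%E.
  move=> /(H 1%N n n id) => h; rewrite -[X in lebesgue_outer X]image_id; apply: h => //.
    by rewrite mul1n.
  by move=> x y d xy i j; rewrite mul1r (ord1 i).
move=> p0 q0 eN; rewrite eN in T *.
by move=> TL V oV; have := lebesgue_outer_lipschitz p0 q0 ler01 TL oV; rewrite expr1n mul1e.
Qed.

(** On flattened matrices, left multiplication by A is Lipschitz for the sup norm, with constant the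
    sum of the absolute values of the entries. An open cover of small volume therefore has an image
    of small outer measure. *)
Lemma lebesgue_outer_mulmx0 (R : realType) m n (A : 'M[R]_m) (Z : set 'M[R]_(m, n)) :
  (0 < m)%N -> (0 < n)%N -> lebesgue_outer Z = 0%E ->
  lebesgue_outer [set A *m y | y in Z] = 0%E.
Proof.
move=> m0 n0 Z0; apply/eqP; rewrite eq_le lebesgue_outer_ge0 andbT.
pose K : R := \sum_i \sum_k `|A i k|.
have K0 : 0 <= K by apply: sumr_ge0 => i _; apply: sumr_ge0.
pose T (x : 'rV[R]_(m * n)) := A *m vec_mx x.
have TL (x y : 'rV[R]_(m * n)) (d : R) : (forall k, `|x ord0 k - y ord0 k| <= d) ->
    forall i j, `|T x i j - T y i j| <= K * d.
  move=> xy i j; have d0 : 0 <= d by exact: le_trans (xy (mxvec_index i j)).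
  rewrite !mxE -sumrB.
  apply: le_trans (ler_norm_sum _ _ _) _.
  apply: (@le_trans _ _ (\sum_k `|A i k| * d)).
    by apply: ler_sum => k _; rewrite !mxE -mulrBr normrM ler_wpM2l.
  rewrite -mulr_suml ler_wpM2r// [leRHS](bigD1 i)//= lerDl.
  by apply: sumr_ge0 => l _; apply: sumr_ge0.
apply/lee_addgt0Pr => e e0; rewrite add0e.
(* The added 1 keeps the divisor positive when [K] is 0. *)
pose c : R := K ^+ (m * n) + 1.
have c0 : 0 < c by rewrite ltr_wpDl// exprn_ge0.
have : (lebesgue_outer Z < (e / c)%:E)%E by rewrite Z0 lte_fin divr_gt0.
move=> /lebesgue_outer_open_cover[a [b [ab Zab Sab]]].
pose U : set 'rV[R]_(m * n) := [set x | (\bigcup_k obox (a k) (b k)) (vec_mx x)].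
have oU : open U.
  apply/open_mxP => x [k _ xk].
  have /open_mxP/(_ _ xk)[d d0 dk] := @open_obox _ _ _ (a k) (b k).
  exists d => // y xy; exists k => //; apply: dk => i j.
  by rewrite !mxE.
apply: (@le_trans _ _ (lebesgue_outer (T @` U))).
  apply: le_lebesgue_outer => _ [y Zy <-]; exists (mxvec y).
    by rewrite /U /= mxvecK; exact: Zab.
  by rewrite /T mxvecK.
apply: le_trans (lebesgue_outer_lipschitz m0 n0 K0 TL oU) _.
have rE : @rowt R (m * n) @^-1` U =
    [set t | (\bigcup_k obox (a k) (b k)) (tmx (@mxvec_index m n) t)].
  apply/funext => t; rewrite /U /=; congr (_ _).
  by apply/matrixP => i j; rewrite !mxE.
have volU : (vol U <= (e / c)%:E)%E.
  apply/ltW; apply: le_lt_trans Sab.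
  have ab' k i j : a k i j <= b k i j by exact/ltW.
  under eq_eseriesr do rewrite -(leb_tmx_mbox (mxvec_index_bij m n) (ab' _)).2.
  apply: (measure_sigma_subadditive (leb R (m * n))) => //.
  - by move=> k; exact: (leb_tmx_mbox (mxvec_index_bij m n) (ab' k)).1.
  - exact: open_measurable_rowt.
  - by rewrite rE => t [k _ tk]; exists k => //; exact: obox_mbox.
apply: le_trans (lee_pmul _ _ (_ : ((K ^+ (m * n))%:E <= c%:E)%E) volU) _.
- by rewrite lee_fin exprn_ge0.
- exact: measure_ge0.
- by rewrite lee_fin lerDl.
by rewrite -EFinM lee_fin mulrC divfK ?gt_eqF.
Qed.

(** * Products of sets of positive outer measure *)

Lemma mvol_recl (R : realType) m n (a b : 'M[R]_(m.+1, n)) :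
  mvol a b = mvol (row ord0 a) (row ord0 b) * mvol (row' ord0 a) (row' ord0 b).
Proof.
rewrite /mvol big_ord_recl big_ord1; congr (_ * _).
  by apply: eq_bigr => j _; rewrite !mxE.
by apply: eq_bigr => i _; apply: eq_bigr => j _; rewrite !mxE.
Qed.

                                                                                       
                                                                                    
(** A Tonelli argument for outer measure. Cover the product by open boxes of total volume below e c,
    where c > 0 is below the outer measure of Z. Over each x in A0 the boxes whose first factor
    contains x cover Z, so their remaining factors have total volume above c. Markov's inequality
    then bounds the outer measure of A0 by e. *)
Lemma lebesgue_outer_stack (R : realType) m n (A0 : set 'rV[R]_n)
    (Z : set 'M[R]_(m.+1, n)) : (0 < n)%N ->
  lebesgue_outer A0 != 0%E -> lebesgue_outer Z != 0%E ->
  lebesgue_outer [set X : 'M[R]_(m.+2, n) | A0 (row ord0 X) /\ Z (row' ord0 X)] != 0%E.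
Proof.
move=> n0 A00 Z0; apply: contra_neqN A00 => /eqP X0.
have [c c0 cZ] : exists2 c : R, 0 < c & (c%:E < lebesgue_outer Z)%E.
  have : (0 < lebesgue_outer Z)%E by rewrite lt_neqAle eq_sym Z0 lebesgue_outer_ge0.
  case: lebesgue_outer => [z| |] //.
    by rewrite lte_fin => z0; exists (z / 2); [lra|rewrite lte_fin; lra].
  by move=> _; exists 1 => //; rewrite ltry.
apply/eqP; rewrite eq_le lebesgue_outer_ge0 andbT.
apply/lee_addgt0Pr => e e0; rewrite add0e.
have : (lebesgue_outer [set X : 'M[R]_(m.+2, n) | A0 (row ord0 X) /\ Z (row' ord0 X)]
  < (e * c)%:E)%E by rewrite X0 lte_fin mulr_gt0.
move=> /lebesgue_outer_open_cover[a [b [ab Zab Sab]]].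
pose B k : set 'rV[R]_n := obox (row ord0 (a k)) (row ord0 (b k)).
pose v k := mvol (row' ord0 (a k)) (row' ord0 (b k)).
have v0 k : 0 <= v k by apply: mvol_ge0 => i j; rewrite !mxE ltW.
have mB k : measurable (@rowt R n @^-1` B k) by apply: open_measurable_rowt; exact: open_obox.
(* [g x] is the total volume of the remaining factors of those boxes whose first factor contains
   [x]. *)
pose g x := (\sum_(0 <= k <oo) (v k)%:E * (\1_(B k) x)%:E)%E.
have g0 x k : (0 <= (v k)%:E * (\1_(B k) x)%:E)%E by rewrite mule_ge0// lee_fin.
pose G := [set x | c%:E < g x]%E.
have A0G : A0 `<=` G.
  move=> x A0x; apply: lt_le_trans cZ _.
  pose C k : set 'M[R]_(m.+1, n) :=
    if x \in B k then mbox (row' ord0 (a k)) (row' ord0 (b k)) else set0.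
  apply: (@le_trans _ _ (lebesgue_outer (\bigcup_k C k))).
    apply: le_lebesgue_outer => z Zz.
    pose X : 'M[R]_(m.+2, n) :=
      \matrix_(i, j) if unlift ord0 i is Some k then z k j else x ord0 j.
    have rX : row ord0 X = x.
      by apply/rowP => j; rewrite !mxE unlift_none.
    have rX' : row' ord0 X = z.
      by apply/matrixP => i j; rewrite !mxE liftK.
    have /Zab[k _ Xk] : [set X | A0 (row ord0 X) /\ Z (row' ord0 X)] X by rewrite /= rX rX'.
    exists k => //; rewrite /C mem_set.
      by move=> i j; have /andP[/ltW + /ltW] := Xk (lift ord0 i) j; rewrite -rX' !mxE => -> ->.
    by move=> i j; rewrite -rX (ord1 i) !mxE; have := Xk ord0 j; rewrite !mxE.
  apply: le_trans (lebesgue_outer_bigcup _) _.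
  apply: lee_nneseries => [k _ _|k _]; first exact: lebesgue_outer_ge0.
  rewrite /C indicE; case: (x \in B k); last by rewrite lebesgue_outer0// mule0.
  by rewrite mule1; apply: lebesgue_outer_box => // i j; rewrite !mxE ltW.
(* [g] is lower semicontinuous: a finite partial sum already exceeds [c], and its finitely many open
   factors containing [x] contain all nearby points. *)
have oG : open G.
  rewrite openE => x Gx.
  have [N cN] : exists N, (c%:E < \sum_(0 <= k < N) (v k)%:E * (\1_(B k) x)%:E)%E.
    apply: contrapT => /forallNP h; move: Gx; apply/negP; rewrite -leNgt.
    apply: lime_le; first by apply: is_cvg_nneseries => k _ _; exact: g0.
    by apply: nearW => N; rewrite leNgt; apply/negP/h.
  have : \forall y \near x, forall k : 'I_N, B k x -> B k y.
    apply: (@filter_forall _ _ (fun (k : 'I_N) y => B k x -> B k y) (nbhs x) _) => k.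
    have [Bx|nBx] := pselect (B k x); last exact: nearW.
    have : nbhs x (B k) by apply: open_nbhs_nbhs; split => //; exact: open_obox.
    by apply: filterS => y By _.
  apply: filterS => y xy; apply: (lt_le_trans cN).
  apply: (@le_trans _ _ (\sum_(0 <= k < N) (v k)%:E * (\1_(B k) y)%:E)%E).
    rewrite !big_mkord; apply: lee_sum => k _.
    rewrite lee_wpmul2l ?lee_fin// !indicE.
    have [xB|] := boolP (x \in B k); last by rewrite ler0n.
    by rewrite (_ : y \in B k)// inE; apply: xy; rewrite inE in xB.
  by apply: nneseries_lim_ge => k _ _; exact: g0.
apply: le_trans (le_lebesgue_outer A0G) _.
apply: le_trans (outer_le_vol n0 oG) _.
have mG := open_measurable_rowt oG.
(* Markov's inequality, with the integral of [g] equal to the sum of the box volumes. *)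
suff : (c%:E * vol G <= (e * c)%:E)%E.
  by rewrite mulrC EFinM lee_pmul2l// ?lte_fin//.
have -> : (c%:E * vol G = \int[leb R n]_t (c%:E * (\1_G (rowt t))%:E))%E.
  rewrite ge0_integralZl//; last 2 first.
  - exact/measurable_EFinP/measurable_indic.
  - by rewrite lee_fin ltW.
  by rewrite integral_indic// setIT.
have mg k : measurable_fun setT (fun t => (v k)%:E * (\1_(B k) (rowt t))%:E : \bar R)%E.
  apply: emeasurable_funM; first exact: measurable_cst.
  by apply/measurable_EFinP; apply: (measurable_indic (mB k)).
apply: (@le_trans _ _ (\int[leb R n]_t g (rowt t))%E).
  apply: ge0_le_integral => //.
  - by move=> t _; rewrite mule_ge0// lee_fin// ltW.
  - by apply: emeasurable_funM => //; exact/measurable_EFinP/measurable_indic.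
  - exact: (@ge0_emeasurable_sum _ _ _ _ (fun k t => (v k)%:E * (\1_(B k) (rowt t))%:E)%E xpredT).
  move=> t _; rewrite indicE.
  have [|] := boolP (_ \in G); rewrite ?inE => Gt.
    by rewrite mule1; exact: ltW.
  by rewrite mule0; exact: nneseries_ge0.
rewrite integral_nneseries//.
apply/ltW; apply: le_lt_trans Sab; apply: lee_nneseries.
  by move=> k _ _; apply: integral_ge0 => t _; exact: g0.
move=> k _; rewrite ge0_integralZl//; last 2 first.
- by apply/measurable_EFinP; apply: (measurable_indic (mB k)).
- by rewrite lee_fin.
have -> : (\int[leb R n]_t (\1_(B k) (rowt t))%:E = vol (B k))%E.
  by have := integral_indic (leb R n) measurableT (mB k); rewrite setIT.
rewrite mvol_recl mulrC EFinM lee_wpmul2l ?lee_fin//.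
rewrite -vol_mbox; last by move=> i j; rewrite !mxE ltW.
apply: le_measure; rewrite ?inE//.
  have abk i j : row ord0 (a k) i j <= row ord0 (b k) i j by rewrite !mxE ltW.
  by have [] := leb_tmx_mbox (row_index_bij n) abk.
by move=> t; exact: obox_mbox.
Qed.

Lemma lebesgue_outer_rows (R : realType) m n (A : 'I_m.+1 -> set 'rV[R]_n) :
  (0 < n)%N -> (forall j, lebesgue_outer (A j) != 0%E) ->
  lebesgue_outer [set X : 'M[R]_(m.+1, n) | forall j, A j (row j X)] != 0%E.
Proof.
move=> n0; elim: m A => [|m IH] A A0.
  rewrite (_ : [set _ | _] = A ord0)//.
  have rX (X : 'rV[R]_n) : row ord0 X = X by apply/rowP => j; rewrite mxE.
  apply/seteqP; split => X /=; first by move=> /(_ ord0); rewrite rX.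
  by move=> AX j; rewrite (ord1 j) rX.
have := lebesgue_outer_stack n0 (A0 ord0) (IH _ (fun j => A0 (lift ord0 j))).
congr (lebesgue_outer _ != _); apply/seteqP; split => X /=.
  move=> [X0 XS] j; case: (unliftP ord0 j) => [k ->|-> //].
  have := XS k; congr (A _ _); apply/rowP => l; by rewrite !mxE.
move=> AX; split => // j; have := AX (lift ord0 j); congr (A _ _).
by apply/rowP => l; rewrite !mxE.
Qed.

                               

                                                                                     
                                                                                       
                                                                                          
(** * Steiner symmetrization on a line *)

Section steiner_line.
Context (R : realType).
Local Notation mu := (@lebesgue_measure R).
Variables (F : set (measurableTypeR R)) (c : R).
Hypotheses (mF : measurable F)
  (F_bnd : exists K : R, forall s, F s -> `|s : R| <= K).

(** For nonempty F this is the open interval about [c] whose length is the diameter of F, not its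
    measure. It can only be longer than the usual symmetral, and membership is witnessed by two
    points of F. *)
Let D : set (measurableTypeR R) :=
  [set s | exists s1 s2, [/\ F s1, F s2 & 2 * `|s - c| < s2 - s1]].
Hypothesis mD : measurable D.

Let width : F !=set0 -> exists2 w : R, (mu F <= w%:E)%E & ball c (w / 2) `<=` D.
Proof.
move=> F0; have [K FK] := F_bnd.
have hs : has_sup F.
  by split=> //; exists K => s /FK; rewrite ler_norml => /andP[].
have hi : has_inf F.
  by split=> //; exists (- K) => s /FK; rewrite ler_norml => /andP[].
exists (sup F - inf F).
  apply: (@le_trans _ _ (mu (`[inf F, sup F]%classic : set (measurableTypeR R)))).
    apply: le_measure; rewrite ?inE//.
    move=> s Fs; rewrite /= in_itv /=; apply/andP; split.
      by apply: ge_inf => //; case: hi.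
    by apply: ub_le_sup => //; case: hs.
  rewrite lebesgue_measure_itvcc//; have [s Fs] := F0.
  apply: (@le_trans _ _ (s : R)); first by apply: ge_inf => //; case: hi.
  by apply: ub_le_sup => //; case: hs.
move=> s; rewrite /ball /= distrC => sw.
have e0 : 0 < (sup F - inf F - 2 * `|s - c|) / 2 by lra.
have [s2 Fs2 s2P] := sup_adherent e0 hs.
have [s1 Fs1 s1P] := inf_adherent e0 hi.
by exists s1, s2; split => //; lra.
Qed.

Lemma lebesgue_steiner_line : (mu F <= mu D)%E.
Proof.
have [->|/set0P/width[w Fw wD]] := eqVneq F set0; first by rewrite measure0.
have w0 : 0 <= w by rewrite -lee_fin (le_trans _ Fw).
apply: le_trans Fw _.
apply: (@le_trans _ _ (mu (ball c (w / 2) : set (measurableTypeR R)))).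
  by rewrite lebesgue_measure_ball ?divr_ge0// lee_fin; lra.
by apply: le_measure; rewrite ?inE//; exact: measurable_ball.
Qed.

(** The points counted in the second term lie in F outside J, and their translates lie in J outside
    F. So the left side is at most the measure of F and at most that of J. [D] and J both contain an
    interval centred at [c] of such length, and the shorter of the two lies in their
    intersection. *)
Lemma lebesgue_steiner_line_gain (b v : R) :
  let J := ball c b : set (measurableTypeR R) in
  (mu (F `&` J) + mu [set s : measurableTypeR R | (F `\` J) s /\ (J `\` F) (v + s)%R]
   <= mu (D `&` J))%E.
Proof.
rewrite /=; set J : set (measurableTypeR R) := ball c b.
have mJ : measurable J by exact: measurable_ball.
set G := [set s | _].
have mFJ : measurable (F `&` J) by exact: measurableI.
have mG : measurable G.
  rewrite (_ : G = (F `\` J) `&` [set s : measurableTypeR R | (J `\` F) (v + s : R)])//.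
  apply: measurableI; first exact: measurableD.
  apply: (@measurable_preimage _ _ _ _ (fun s : measurableTypeR R => v + s : measurableTypeR R)).
    by apply: (@measurable_funD _ _ _ _ (cst v) id); [exact: measurable_cst|exact: measurable_id].
  exact: measurableD.
have sF : (mu (F `&` J) + mu G <= mu F)%E.
  rewrite -measureU//; last by apply/seteqP; split => // s [[_ ?] [[]]].
  apply: le_measure; rewrite ?inE//; first exact: measurableU.
  by move=> s [[]//|[[]]].
have sJ : (mu (F `&` J) + mu G <= mu J)%E.
  apply: (@le_trans _ _ (mu (F `&` J) + mu (J `\` F))%E).
    rewrite leeD2l// -[leRHS](lebesgue_measure_shift v); last exact: measurableD.
    apply: le_measure; rewrite ?inE//; last by move=> s [].
    apply: (@measurable_preimage _ _ _ _ (fun s : measurableTypeR R => v + s : measurableTypeR R)).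
      by apply: (@measurable_funD _ _ _ _ (cst v) id); [exact: measurable_cst|exact: measurable_id].
    exact: measurableD.
  rewrite -measureU//; last 2 first.
  - exact: measurableD.
  - by apply/seteqP; split => // s [[? ?] []].
  apply: le_measure; rewrite ?inE//; first by apply: measurableU => //; exact: measurableD.
  by move=> s [[]|[]].
have [F0|/set0P/width[w Fw wD]] := eqVneq F set0.
  by apply: le_trans sF _; rewrite F0 measure0.
have w0 : 0 <= w by rewrite -lee_fin (le_trans _ Fw).
have [b0|b0] := ltP b 0.
  by rewrite (le_trans sJ)// /J (ball0 _ _).2 ?measure0// ltW.
have h0 : 0 <= Num.min (w / 2) b by rewrite le_min b0 divr_ge0.
(* The shorter of the intervals of half-lengths [w / 2] and [b] about [c]. *)
apply: (@le_trans _ _ (mu (ball c (Num.min (w / 2) b) : set (measurableTypeR R)))).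
  rewrite lebesgue_measure_ball//; have [wb|bw] := leP (w / 2) b.
    by apply: le_trans sF (le_trans Fw _); rewrite lee_fin; lra.
  by rewrite -(lebesgue_measure_ball c).
apply: le_measure; rewrite ?inE//; first exact: measurable_ball.
  exact: measurableI.
move=> s cs; split; first by apply: wD; apply: le_ball cs; rewrite ge_min lexx.
by apply: le_ball cs; rewrite ge_min lexx orbT.
Qed.

End steiner_line.

(** * Steiner symmetrization of open sets, its volume and its overlap with balls *)

Definition dot (R : realType) n (x y : 'rV[R]_n) : R := \sum_i x ord0 i * y ord0 i.

Section dot.
Context (R : realType) (n : nat).
Implicit Types x y u : 'rV[R]_n.

Lemma dotDl x y u : dot (x + y) u = dot x u + dot y u.
Proof. by rewrite -big_split; apply: eq_bigr => i _; rewrite mxE mulrDl. Qed.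

Lemma dotZl k x u : dot (k *: x) u = k * dot x u.
Proof. by rewrite mulr_sumr; apply: eq_bigr => i _; rewrite mxE mulrA. Qed.

Lemma dotC x y : dot x y = dot y x.
Proof. by apply: eq_bigr => i _; rewrite mulrC. Qed.

Lemma dot_gt0 u i : u ord0 i != 0 -> 0 < dot u u.
Proof.
move=> ui; rewrite /dot (bigD1 i)//= ltr_wpDr//.
  by apply: sumr_ge0 => j _; rewrite -expr2 sqr_ge0.
by rewrite -expr2 exprn_even_gt0.
Qed.

Lemma enorm_lt x r : 0 < r -> (enorm x < r) = (dot x x < r ^+ 2).
Proof.
move=> r0; have rE : r = Num.sqrt (r ^+ 2) by rewrite sqrtr_sqr gtr0_norm.
by rewrite {1}rE ltr_sqrt ?exprn_gt0.
Qed.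

Lemma dot_line x u s : 0 < dot u u -> dot (x + s *: u) (x + s *: u) =
  dot x x + dot u u * ((dot x u / dot u u + s) ^+ 2 - (dot x u / dot u u) ^+ 2).
Proof.
move=> u0; rewrite dotDl dotZl (dotC x) (dotC u) !dotDl !dotZl (dotC u x).
by field; rewrite gt_eqF.
Qed.

Lemma coord_le_enorm x i : `|x ord0 i| <= enorm x.
Proof.
rewrite -sqrtr_sqr ler_wsqrtr// (bigD1 i)//= lerDl.
by apply: sumr_ge0 => j _; rewrite sqr_ge0.
Qed.

End dot.

                                                                                   
                                                                                     
                                                             
(** Symmetrization about the hyperplane orthogonal to [u]: each section parallel to [u] becomes a
    centred open interval with the diameter of the section as length. The quotient of dot products
    is the coordinate of x along [u]. The two-endpoint form is the one consumed by [det_steiner]. *)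
Definition steiner (R : realType) n (u : 'rV[R]_n) (U : set 'rV[R]_n) : set 'rV[R]_n :=
  [set x | exists s1 s2, [/\ U (x + s1 *: u), U (x + s2 *: u) &
                             2 * `|dot x u / dot u u| < s2 - s1]].

Lemma open_steiner (R : realType) n (u : 'rV[R]_n) U : open U -> open (steiner u U).
Proof.
move=> /open_mxP oU; apply/open_mxP => x [s1 [s2 [U1 U2 s12]]].
have [e1 e10 eU1] := oU _ U1; have [e2 e20 eU2] := oU _ U2.
pose C := (\sum_i `|u ord0 i|) / `|dot u u|.
have C0 : 0 <= C by rewrite divr_ge0// sumr_ge0.
pose gap := s2 - s1 - 2 * `|dot x u / dot u u|.
have gap0 : 0 < gap by rewrite subr_gt0.
have C1 : 0 < 2 * (C + 1) by lra.
pose e := Num.min (Num.min e1 e2) (gap / (2 * (C + 1))).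
have e0 : 0 < e by rewrite !lt_min e10 e20 divr_gt0.
exists e => // y xy.
have shift s i j : (x + s *: u) i j - (y + s *: u) i j = x i j - y i j.
  by rewrite !mxE; ring.
exists s1, s2; split.
- apply: eU1 => i j; rewrite shift; apply: lt_le_trans (xy i j) _.
  by rewrite !ge_min lexx.
- apply: eU2 => i j; rewrite shift; apply: lt_le_trans (xy i j) _.
  by rewrite !ge_min lexx orbT.
have : `|dot y u / dot u u - dot x u / dot u u| <= C * e.
  rewrite -mulrBl normrM normfV /C -mulrA (mulrC _ e) mulrA ler_wpM2r ?invr_ge0//.
  rewrite -sumrB; apply: le_trans (ler_norm_sum _ _ _) _.
  rewrite mulr_suml; apply: ler_sum => i _.
  by rewrite -mulrBl normrM mulrC ler_wpM2l// distrC ltW.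
have eg : e * (2 * (C + 1)) <= gap.
  by rewrite -ler_pdivlMr// !ge_min lexx orbT.
have := ler_normB (dot y u / dot u u - dot x u / dot u u) (- (dot x u / dot u u)).
rewrite opprK subrK normrN /gap in eg *; nra.
Qed.

(** Of the two witnesses in U, at least one is farther from the hyperplane than x on the same line,
    hence has larger norm: otherwise s2 - s1 would be at most twice the distance coordinate of x. *)
Lemma steiner_ball0 (R : realType) n (u : 'rV[R]_n) U (r : R) : 0 < dot u u -> 0 < r ->
  U `<=` @Defs.ball0 R n r -> steiner u U `<=` @Defs.ball0 R n r.
Proof.
move=> u0 r0 Ur x [s1 [s2 [/Ur + /Ur +]]].
rewrite /Defs.ball0 /= !enorm_lt// !dot_line//; set t := dot x u / dot u u.
move=> U1 U2; have [h1|h1] := ltP `|t| `|t + s1|.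
  move=> _; apply: le_lt_trans U1; rewrite lerDl mulr_ge0 ?(ltW u0)// subr_ge0.
  by rewrite -(real_normK (num_real t)) -(real_normK (num_real (t + s1))) ler_sqr ?nnegrE// ltW.
have [h2|h2 h] := ltP `|t| `|t + s2|.
  move=> _; apply: le_lt_trans U2; rewrite lerDl mulr_ge0 ?(ltW u0)// subr_ge0.
  by rewrite -(real_normK (num_real t)) -(real_normK (num_real (t + s2))) ler_sqr ?nnegrE// ltW.
exfalso; have := ler_norm (t + s2); have := ler_norm (- (t + s1)); rewrite normrN; lra.
Qed.

Lemma tscale_tcons (R : realType) n (k : R) (p : measurableTypeR R * pt R n) :
  tscale k (tcons p) = tcons (k * p.1 : R, tscale k p.2).
Proof.
apply: eq_from_tnth => i; rewrite tnth_mktuple.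
case: (unliftP ord0 i) => [j ->|->]; first by rewrite !tconsS tnth_mktuple.
by rewrite !tcons0.
Qed.

Lemma open_ball0 (R : realType) n (r : R) : open (@Defs.ball0 R n r).
Proof.
apply/open_mxP => x xr.
have r0 : 0 < r by rewrite (le_lt_trans _ xr)// sqrtr_ge0.
pose P : {poly R} := \sum_(i < n) (`|x ord0 i|%:P + 'X) ^+ 2.
have PE e : P.[e] = \sum_(i < n) (`|x ord0 i| + e) ^+ 2.
  by rewrite horner_sum; apply: eq_bigr => i _; rewrite !hornerE.
have P0 : P.[0] = dot x x.
  rewrite PE; apply: eq_bigr => i _.
  by rewrite addr0 real_normK ?num_real// expr2.
have gap : 0 < r ^+ 2 - P.[0] by rewrite subr_gt0 P0 -enorm_lt.
have /cvgrPdist_lt/(_ _ gap) := @continuous_horner R P 0.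
move=> /nbhs_ballP[e /= e0 eP]; exists (e / 2); first exact: divr_gt0.
move=> y xy; rewrite /Defs.ball0 /= enorm_lt//.
have : `|P.[0] - P.[e / 2]| < r ^+ 2 - P.[0].
  by apply: eP; rewrite /ball /= sub0r normrN gtr0_norm ?divr_gt0//; lra.
rewrite ltr_norml => /andP[h _].
apply: (@le_lt_trans _ _ P.[e / 2]); last by lra.
rewrite PE; apply: ler_sum => i _; rewrite -expr2 -(real_normK (num_real (y _ _))).
rewrite ler_sqr ?nnegrE ?addr_ge0// ?divr_ge0// ?(ltW e0)//.
have -> : y ord0 i = x ord0 i - (x ord0 i - y ord0 i) by rewrite opprB addrC subrK.
by rewrite (le_trans (ler_normB _ _))// lerD2l ltW.
Qed.

Section steiner_volume.
Context (R : realType) (n : nat) (w : pt R n) (U : set 'rV[R]_n.+1) (r0 : R).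
Hypotheses (oU : open U) (U_bnd : U `<=` @Defs.ball0 R n.+1 r0).
Local Notation mu := (@lebesgue_measure R).

Let d : 'rV[R]_n.+1 := rowt (tcons (1 : measurableTypeR R, w)).
Let p (z : pt R n) : 'rV[R]_n.+1 := rowt (tcons (0 : measurableTypeR R, z)).
Let line s z : pt R n.+1 := tcons (s, tadd (tscale s w) z).
(** The parameter at which the line through [p z] comes closest to the origin, that is, where it
    meets the hyperplane orthogonal to [d]. *)
Let c z := - (dot (p z) d / dot d d).
Let F z : set (measurableTypeR R) := [set s | U (p z + s *: d)].

Let lineE s z : rowt (line s z) = p z + s *: d.
Proof.
apply/rowP => i; rewrite !mxE; case: (unliftP ord0 i) => [j ->|->].
  by rewrite !tconsS !tnth_mktuple addrC.
by rewrite !tcons0 add0r mulr1.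
Qed.

Let dd_gt0 : 0 < dot d d.
Proof. by apply: (@dot_gt0 _ _ _ ord0); rewrite mxE tcons0 /= oner_neq0. Qed.

Let dot_p s z : dot (p z + s *: d) d / dot d d = s - c z.
Proof. by rewrite dotDl dotZl /c opprK mulrDl mulfK ?gt_eqF// addrC. Qed.

Let F_bnd z : exists K : R, forall s, F z s -> `|s : R| <= K.
Proof.
exists r0 => s /U_bnd; rewrite /Defs.ball0 /= => h.
apply: le_trans (ltW h); apply: le_trans (coord_le_enorm _ ord0).
by rewrite !mxE !tcons0 add0r mulr1.
Qed.

Let mU := open_measurable_rowt oU.
Let oS := open_steiner (u := d) oU.
Let mS := open_measurable_rowt oS.

Let line_preimage (A : set 'rV[R]_n.+1) z :
  [set s : measurableTypeR R | (@rowt R n.+1 @^-1` A) (line s z)] =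
  [set s | A (p z + s *: d)].
Proof. by apply/funext => s /=; rewrite lineE. Qed.

Let steiner_lineE z : [set s : measurableTypeR R | steiner d U (p z + s *: d)] =
  [set s | exists s1 s2, [/\ F z s1, F z s2 & 2 * `|s - c z| < s2 - s1]].
Proof.
apply/seteqP; split => s.
  move=> [s1 [s2]]; rewrite dot_p => -[U1 U2 s12].
  exists (s + s1), (s + s2); split; last by lra.
    by rewrite /F /= scalerDl addrA.
  by rewrite /F /= scalerDl addrA.
move=> [s1 [s2 [U1 U2 s12]]].
exists (s1 - s), (s2 - s); rewrite -!addrA -!scalerDl !subrKC; split => //.
by rewrite dot_p; lra.
Qed.

Let mF z : measurable (F z).
Proof. by have := measurable_line w z mU; rewrite line_preimage. Qed.

Let mD z : measurable
  [set s : measurableTypeR R | exists s1 s2, [/\ F z s1, F z s2 & 2 * `|s - c z| < s2 - s1]].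
Proof. by have := measurable_line w z mS; rewrite line_preimage steiner_lineE. Qed.

Lemma vol_steiner : (vol U <= vol (steiner d U))%E.
Proof.
rewrite /vol (leb_lines w mU) (leb_lines w mS).
apply: ge0_le_integral => //.
- exact: measurable_fun_line.
- exact: measurable_fun_line.
move=> z _; rewrite !line_preimage steiner_lineE.
exact: (lebesgue_steiner_line (mF z) (F_bnd z) (mD z)).
Qed.

Let ball0_line r z : 0 < r -> exists b,
  [set s : measurableTypeR R | @Defs.ball0 R n.+1 r (p z + s *: d)] = ball (c z) b.
Proof.
move=> r_gt0; pose k := dot (p z) (p z) - dot d d * (c z) ^+ 2.
(* If the line misses the ball, the radicand is nonpositive, the square root is 0 and the interval
   is empty, as it should be. *)
exists (Num.sqrt ((r ^+ 2 - k) / dot d d)).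
apply/seteqP; split => s; rewrite /Defs.ball0 /ball /= enorm_lt// dot_line//.
all: have -> : dot (p z) d / dot d d = - c z by rewrite /c opprK.
all: rewrite sqrrN (addrC (- c z)) distrC -(sqrtr_sqr (s - c z)).
all: rewrite /k; move: dd_gt0 (sqr_ge0 (s - c z)).
all: move: ((s - c z) ^+ 2) ((c z) ^+ 2) (dot (p z) (p z)) (dot d d) (r ^+ 2).
all: move=> t c2 pp dd r2 dd0 t0 h.
  have h' : t < (r2 - (pp - dd * c2)) / dd by rewrite ltr_pdivlMr//; lra.
  by rewrite ltr_sqrt// (le_lt_trans t0).
have [k0|k0] := leP ((r2 - (pp - dd * c2)) / dd) 0.
  by move: h; rewrite (ler0_sqrtr k0) ltNge sqrtr_ge0.
by move: h; rewrite ltr_sqrt// ltr_pdivlMr//; lra.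
Qed.

(** Translation by k (1, w) keeps every line of the slicing and moves its parameter by k, and a
    centred ball cuts each line in an interval about [c z]. So the one-dimensional gain integrates
    over the lines. *)
Lemma vol_steiner_gain (r k : R) : 0 < r ->
  (vol (U `&` @Defs.ball0 R n.+1 r) +
   leb R n.+1 [set x | (U `\` @Defs.ball0 R n.+1 r) (rowt x) /\
     (@Defs.ball0 R n.+1 r `\` U) (rowt (tadd x (tscale k (tcons (1%R : measurableTypeR R, w)))))]
   <= vol (steiner d U `&` @Defs.ball0 R n.+1 r))%E.
Proof.
move=> r_gt0; set B := @Defs.ball0 R n.+1 r.
have oB : open B by exact: open_ball0.
have mB := open_measurable_rowt oB.
have oUB : open (U `&` B) by exact: openI.
have oSB : open (steiner d U `&` B) by exact: openI.
have mUB := open_measurable_rowt oUB; have mSB := open_measurable_rowt oSB.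
set G := [set x | _].
have mG : measurable G.
  by apply: (@measurable_conv R n.+1 (@rowt R n.+1 @^-1` (U `\` B))
    (@rowt R n.+1 @^-1` (B `\` U))); exact: measurableD.
rewrite /vol (leb_lines w mUB) (leb_lines w mSB) (leb_lines w mG).
rewrite -ge0_integralD//; last 2 first.
- exact: measurable_fun_line.
- exact: measurable_fun_line.
apply: ge0_le_integral => //.
- by move=> z _; exact: adde_ge0.
- by apply: emeasurable_funD; exact: measurable_fun_line.
- exact: measurable_fun_line.
move=> z _; rewrite !line_preimage.
have [b bE] := ball0_line z r_gt0.
have -> : [set s : measurableTypeR R | (steiner d U `&` B) (p z + s *: d)] =
   [set s | exists s1 s2, [/\ F z s1, F z s2 & 2 * `|s - c z| < s2 - s1]] `&` ball (c z) b.
  by rewrite -bE -steiner_lineE.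
have -> : [set s : measurableTypeR R | (U `&` B) (p z + s *: d)] = F z `&` ball (c z) b.
  by rewrite -bE.
have -> : [set s : measurableTypeR R | G (line s z)] =
  [set s : measurableTypeR R | (F z `\` ball (c z) b) s /\ (ball (c z) b `\` F z) (k + s)%R].
  rewrite -bE; apply/funext => s; rewrite /G /= lineE.
  rewrite (_ : tadd _ _ = line (k + s) z) ?lineE//.
  rewrite /line tscale_tcons tadd_tcons /=; congr (tcons (_, _)); first by rewrite mulr1 addrC.
  by apply: eq_from_tnth => i; rewrite !tnth_mktuple; ring.
exact: (lebesgue_steiner_line_gain (mF z) (F_bnd z) (mD z)).
Qed.

End steiner_volume.

                                 

(** * Determinant bounds under symmetrization *)

Lemma det_add_mul_col_row (R : comNzRingType) n (Q : 'M[R]_n) (u : 'rV[R]_n) :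
  exists psi : 'rV[R]_n, forall q : 'cV[R]_n,
    \det (Q + q *m u) = \det Q + (psi *m q) 0 0.
Proof.
(* [Q + q *m u] is the Schur complement of the corner 1. Expanding the block determinant along its
   first column, the only place where [q] occurs, shows affine dependence on [q]. *)
pose M (q : 'cV[R]_n) : 'M[R]_(1 + n) := block_mx 1%:M (- u) q Q.
have detM q : \det (M q) = \det (Q + q *m u).
  have -> : M q = block_mx 1%:M 0 q 1%:M *m block_mx 1%:M (- u) 0 (Q + q *m u).
    rewrite mulmx_block !mul1mx !mul0mx !mulmx1 !addr0 mulmxN.
    by rewrite (addrC Q) addKr.
  by rewrite det_mulmx det_lblock det_ublock !det1 !mul1r.
pose cf i := cofactor (M 0) i ord0.
have cfE q i : cofactor (M q) i ord0 = cf i.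
  rewrite /cf /cofactor; congr (_ * \det _); apply/matrixP => k l.
  by rewrite [LHS]mxE [LHS]mxE [RHS]mxE [RHS]mxE -rshift1 /M !block_mxEh !row_mxEr.
have expand q : \det (Q + q *m u) = cf ord0 + \sum_i q i 0 * cf (lift ord0 i).
  rewrite -detM (expand_det_col _ ord0) big_ord_recl cfE; congr (_ + _).
    rewrite (_ : M q _ _ = M q (lshift n ord0) (lshift n ord0)).
      by rewrite block_mxEul mxE eqxx mul1r.
    by congr (M q _ _); exact/val_inj.
  apply: eq_bigr => i _; rewrite cfE; congr (_ * _).
  rewrite (_ : M q _ _ = M q (rshift 1 i) (lshift n ord0)).
    by rewrite block_mxEdl.
  by congr (M q _ _); exact/val_inj.
exists (\row_i cf (lift ord0 i)) => q; rewrite expand; congr (_ + _).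
  rewrite -[Q in RHS]addr0 -[0 in RHS](mul0mx _ u) expand big1 ?addr0// => i _.
  by rewrite mxE mul0r.
by rewrite mxE; apply: eq_bigr => i _; rewrite mxE mulrC.
Qed.

                                                                                            
                                                                                         
                                                           
(** Split each row into its part orthogonal to u and its component t_j along u. With the orthogonal
    parts fixed, the determinant is a linear form sum a_j c_j in the components. Replacing each t_j
    by t_j + s1_j or t_j + s2_j according to the sign of a_j gives two admissible values in [-M, M],
    whose difference is sum |a_j| (s2_j - s1_j), at least twice |sum a_j t_j|. *)
Lemma det_steiner (R : realType) m n (C : 'M[R]_(n, m)) (u : 'rV[R]_n)
    (U : 'I_m -> set 'rV[R]_n) (M : R) : 0 < dot u u ->
  (forall X : 'M[R]_(m, n), (forall j, U j (row j X)) -> `|\det (C *m X)| <= M) ->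
  forall X : 'M[R]_(m, n), (forall j, steiner u (U j) (row j X)) -> `|\det (C *m X)| <= M.
Proof.
move=> u0 UM X XU.
have [s1 XU1] := choice XU.
have [s2 XU2] := choice XU1.
pose t : 'cV[R]_m := \col_j (dot (row j X) u / dot u u).
pose Q := C *m (X - t *m u).
have [psi psiE] := det_add_mul_col_row Q u.
(* The rows of [X - t *m u] are orthogonal to [u], so [Q] kills the transpose of [u]; this removes
   the constant term of the affine form. *)
have Q0 : \det Q = 0.
  rewrite -det_tr; apply/eqP/det0P; exists u.
    by apply: contraTneq u0 => ->; rewrite /dot big1 ?ltxx// => i _; rewrite mxE mul0r.
  rewrite -[u in LHS]trmxK -trmx_mul -[RHS]trmx0; congr trmx.
  rewrite -mulmxA mulmxBl (_ : _ - _ = 0) ?mulmx0//; apply/eqP; rewrite subr_eq0; apply/eqP.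
  apply/colP => j; rewrite -mulmxA !mxE big_ord1 !mxE.
  have dotE (x y : 'rV[R]_n) : \sum_k x ord0 k * y^T k ord0 = dot x y.
    by apply: eq_bigr => k _; rewrite mxE.
  rewrite (dotE u u) divfK ?gt_eqF//.
  by apply: eq_bigr => k _; rewrite !mxE.
have DE (c : 'cV[R]_m) : \det (C *m (X + (c - t) *m u)) = \sum_j (psi *m C) 0 j * c j 0.
  have -> : C *m (X + (c - t) *m u) = Q + (C *m c) *m u.
    by rewrite /Q -!mulmxA -mulmxDr mulmxBl addrA addrAC.
  by rewrite psiE Q0 add0r mulmxA mxE.
pose a j := (psi *m C) 0 j.
(* [sp] maximises and [sm] minimises the linear form over the choices of endpoints. *)
pose sp : 'cV[R]_m := \col_j (if 0 <= a j then s2 j else s1 j).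
pose sm : 'cV[R]_m := \col_j (if 0 <= a j then s1 j else s2 j).
have Dle (s : 'cV[R]_m) : (forall j, s j 0 = s1 j \/ s j 0 = s2 j) ->
    `|\sum_j a j * (t + s) j 0| <= M.
  move=> sj; rewrite -DE (addrC t) addrK; apply: UM => j.
  have -> : row j (X + s *m u) = row j X + s j 0 *: u.
    by apply/rowP => k; rewrite !mxE big_ord1.
  have [U1 U2 _] := XU2 j.
  by case: (sj j) => ->.
have Dp : `|\sum_j a j * (t + sp) j 0| <= M.
  by apply: Dle => j; rewrite mxE; case: ifP => _; [right|left].
have Dm : `|\sum_j a j * (t + sm) j 0| <= M.
  by apply: Dle => j; rewrite mxE; case: ifP => _; [left|right].
have := DE t; rewrite subrr mul0mx addr0 => ->.
have key : 2 * `|\sum_j a j * t j 0| <=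
    \sum_j a j * (t + sp) j 0 - \sum_j a j * (t + sm) j 0.
  rewrite -sumrB -ler_pdivlMl//.
  apply: le_trans (ler_norm_sum _ _ _) _.
  rewrite mulr_sumr; apply: ler_sum => j _; rewrite -mulrBr.
  have -> : (t + sp) j 0 - (t + sm) j 0 = sp j 0 - sm j 0 by rewrite !mxE; ring.
  rewrite normrM !mxE; have [_ _] := XU2 j.
  by case: (lerP 0 (a j)) => a0 h; [rewrite (ger0_norm a0)|rewrite (ltr0_norm a0)]; nra.
by move: Dp Dm; rewrite !ler_norml => /andP[? ?] /andP[? ?]; rewrite -ler_norml; lra.
Qed.

(** * The determinant is Lipschitz on bounded sets *)

Section locally_lipschitz.
Context (R : realType) (m n : nat).
Implicit Types (g h : 'M[R]_(m, n) -> R).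

(** Being stable under sums and products, this covers the determinant as a polynomial in the
    entries. It serves both as continuity at a point and as a uniform estimate on thickened bounded
    sets. *)
Definition lipschitz_on_bounded g := forall b : R, 0 <= b -> exists2 L : R, 0 <= L &
  forall (X Y : 'M[R]_(m, n)) (d : R), 0 <= d -> (forall i j, `|X i j| <= b) ->
    (forall i j, `|Y i j| <= b) -> (forall i j, `|X i j - Y i j| <= d) ->
    `|g X - g Y| <= L * d.

Lemma lipschitz_cst k : lipschitz_on_bounded (fun=> k).
Proof. by move=> b b0; exists 0 => // X Y d d0 _ _ _; rewrite subrr normr0 mul0r. Qed.

Lemma lipschitz_coord i j : lipschitz_on_bounded (fun X => X i j).
Proof. by move=> b b0; exists 1 => // X Y d d0 _ _ XY; rewrite mul1r. Qed.

Lemma lipschitzD g h : lipschitz_on_bounded g -> lipschitz_on_bounded h ->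
  lipschitz_on_bounded (fun X => g X + h X).
Proof.
move=> lg lh b b0; have [K K0 gK] := lg b b0; have [L L0 hL] := lh b b0.
exists (K + L); first exact: addr_ge0.
move=> X Y d d0 Xb Yb XY; rewrite opprD addrACA (le_trans (ler_normD _ _))//.
by rewrite mulrDl lerD ?gK ?hL.
Qed.

Lemma lipschitzM g h : lipschitz_on_bounded g -> lipschitz_on_bounded h ->
  lipschitz_on_bounded (fun X => g X * h X).
Proof.
move=> lg lh b b0; have [K K0 gK] := lg b b0; have [L L0 hL] := lh b b0.
have bnd f M : 0 <= M ->
    (forall (X Y : 'M[R]_(m, n)) (d : R), 0 <= d -> (forall i j, `|X i j| <= b) ->
    (forall i j, `|Y i j| <= b) -> (forall i j, `|X i j - Y i j| <= d) ->
    `|f X - f Y| <= M * d) ->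
    forall X : 'M[R]_(m, n), (forall i j, `|X i j| <= b) -> `|f X| <= `|f 0| + M * b.
  move=> M0 fM X Xb.
  rewrite -{1}(subrK (f 0) (f X)) addrC (le_trans (ler_normD _ _))// lerD2l.
  by apply: fM => // i j; rewrite !mxE ?normr0 ?subr0.
exists ((`|g 0| + K * b) * L + (`|h 0| + L * b) * K).
  by rewrite addr_ge0// mulr_ge0// addr_ge0// mulr_ge0.
move=> X Y d d0 Xb Yb XY.
have -> : g X * h X - g Y * h Y = g X * (h X - h Y) + h Y * (g X - g Y) by ring.
rewrite (le_trans (ler_normD _ _))// !normrM mulrDl -!mulrA lerD//.
  by apply: ler_pM => //; [exact: bnd|exact: hL].
by apply: ler_pM => //; [exact: bnd|exact: gK].
Qed.

Lemma lipschitz_sum (I : finType) (F : I -> 'M[R]_(m, n) -> R) :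
  (forall i, lipschitz_on_bounded (F i)) -> lipschitz_on_bounded (fun X => \sum_i F i X).
Proof.
move=> lF; rewrite (_ : (fun X => _) = \sum_i F i).
  elim/big_ind : _ => [|g h lg lh|i _]; [exact: lipschitz_cst|exact: lipschitzD|exact: lF].
by apply/funext => X; rewrite fct_sumE.
Qed.

Lemma lipschitz_prod (I : finType) (F : I -> 'M[R]_(m, n) -> R) :
  (forall i, lipschitz_on_bounded (F i)) -> lipschitz_on_bounded (fun X => \prod_i F i X).
Proof.
move=> lF; rewrite (_ : (fun X => _) = \prod_i F i).
  elim/big_ind : _ => [|g h lg lh|i _]; [exact: lipschitz_cst|exact: lipschitzM|exact: lF].
by apply/funext => X; rewrite fct_prodE.
Qed.

Lemma lipschitz_det_mulmx (C : 'M[R]_(n, m)) :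
  lipschitz_on_bounded (fun X => \det (C *m X)).
Proof.
apply: lipschitz_sum => s; apply: lipschitzM; first exact: lipschitz_cst.
apply: lipschitz_prod => i.
under eq_fun do rewrite mxE.
apply: lipschitz_sum => j; apply: lipschitzM; first exact: lipschitz_cst.
exact: lipschitz_coord.
Qed.

Lemma near_lipschitz g (p : 'M[R]_(m, n)) (e : R) : lipschitz_on_bounded g -> 0 < e ->
  exists2 d : R, 0 < d & forall X : 'M[R]_(m, n),
    (forall i j, `|p i j - X i j| < d) -> `|g p - g X| < e.
Proof.
move=> lg e0; pose b := \sum_i \sum_j `|p i j| + 1.
have pb i j : `|p i j| <= b - 1.
  rewrite addrK (bigD1 i)//= (bigD1 j)//= -addrA lerDl addr_ge0//.
    by apply: sumr_ge0.
  by apply: sumr_ge0 => k _; apply: sumr_ge0.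
have b0 : 0 <= b by rewrite addr_ge0// sumr_ge0// => i _; apply: sumr_ge0.
have [L L0 gL] := lg b b0.
pose d := Num.min 1 (e / (L + 1)).
have d0 : 0 < d by rewrite lt_min ltr01 divr_gt0// ltr_wpDl.
exists d => // X pX.
have : `|g p - g X| <= L * d.
  apply: gL => [|i j|i j|i j]; first exact: ltW.
  - by rewrite (le_trans (pb i j))// gerBl.
  - have -> : X i j = p i j - (p i j - X i j) by rewrite opprB addrC subrK.
    rewrite (le_trans (ler_normB _ _))//.
    have := pX i j; rewrite lt_min => /andP[h _]; have := pb i j; lra.
  - exact: ltW.
have : d * (L + 1) <= e by rewrite -ler_pdivlMr ?ltr_wpDl// ge_min lexx orbT.
rewrite mulrDr mulr1 mulrC => h1 h2; lra.
Qed.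

End locally_lipschitz.

(** * From bounded open sets to balls by repeated symmetrization *)

Lemma vol_ball0_lty (R : realType) n (r : R) : (vol (@Defs.ball0 R n r) < +oo)%E.
Proof.
have [r0|r0] := leP r 0.
  rewrite (_ : Defs.ball0 _ = set0) ?/vol ?preimage_set0 ?measure0//.
  by apply/seteqP; split => // x; rewrite /Defs.ball0 /= ltNge (le_trans r0)// sqrtr_ge0.
have ab i j : (const_mx (- r) : 'rV[R]_n) i j <= (const_mx r : 'rV[R]_n) i j.
  by rewrite !mxE; lra.
have [mb vb] := leb_tmx_mbox (row_index_bij n) ab.
apply: (@le_lt_trans _ _ (vol (mbox (const_mx (- r)) (const_mx r : 'rV[R]_n)))).
  apply: le_measure; rewrite ?inE//; first exact: open_measurable_rowt (@open_ball0 R n r).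
  move=> t tr i j; rewrite !mxE -ler_norml.
  by have := coord_le_enorm (rowt t) j; rewrite mxE => /le_trans; apply; exact: ltW.
by rewrite vol_mbox// ltry.
Qed.

Section ball_vs_sets.
Context (R : realType) (m n : nat) (C : 'M[R]_(n.+1, m)) (M K : R) (r : 'I_m -> R).
Hypothesis rK : forall j, 0 < r j <= K.
Implicit Type V : 'I_m -> set 'rV[R]_n.+1.
Local Notation B j := (@Defs.ball0 R n.+1 (r j)).

(** The invariants preserved by symmetrizing all the V_j in a common direction. *)
Let admissible V := [/\ forall j, open (V j), forall j, V j `<=` @Defs.ball0 R n.+1 K,
  forall j, (vol (B j) <= vol (V j))%E &
  forall X, (forall j, V j (row j X)) -> `|\det (C *m X)| <= M].

Let overlap V := (\sum_j vol (V j `&` B j))%E.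

Let mB j := open_measurable_rowt (@open_ball0 R n.+1 (r j)).

Variable p : 'M[R]_(m, n.+1).
Hypotheses (pB : forall j, B j (row j p)) (pM : M < `|\det (C *m p)|).

Let box e j : set 'rV[R]_n.+1 := [set x | forall i k, `|row j p i k - x i k| < e].

Let box_exists : exists2 e, 0 < e & (forall j, box e j `<=` B j) /\
  forall X, (forall j, box e j (row j X)) -> M < `|\det (C *m X)|.
Proof.
have e0 : 0 < `|\det (C *m p)| - M by rewrite subr_gt0.
have [d d0 dP] := near_lipschitz p (lipschitz_det_mulmx C) e0.
have [e eP] : {e : 'I_m -> R & forall j, 0 < e j /\ box (e j) j `<=` B j}.
  apply: (@choice _ _ (fun j e => 0 < e /\ box e j `<=` B j)) => j.
  have /open_mxP/(_ _ (pB j))[e0' e00 eB] := @open_ball0 R n.+1 (r j).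
  by exists e0'; split => // x xe; exact: eB.
exists (\big[Num.min/d]_j e j); first by apply/bigmin_gtP; split => // j _; have [] := eP j.
split=> [j x xe|X Xe].
  apply: (eP j).2 => i k; apply: lt_le_trans (xe i k) _; exact: bigmin_le_cond.
have : `|\det (C *m p) - \det (C *m X)| < `|\det (C *m p)| - M.
  apply: dP => j k; have := Xe j 0 k; rewrite !mxE => /lt_le_trans; apply.
  exact: bigmin_le_id.
have := ler_normD (\det (C *m p) - \det (C *m X)) (\det (C *m X)).
by rewrite subrK; lra.
Qed.

Let vol_box e j : 0 < e ->
  measurable (@rowt R n.+1 @^-1` box e j) /\ vol (box e j) = ((2 * e) ^+ n.+1)%:E.
Proof.
move=> e0.
pose I k : set (measurableTypeR R) := ball (p j k) e.
have IE : @rowt R n.+1 @^-1` box e j = [set t | forall k, I k (tnth t k)].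
  apply/seteqP; split => t /= h => [k|i k].
    by have := h ord0 k; rewrite !mxE.
  by have := h k; rewrite !mxE.
have mI k : measurable (I k) by exact: measurable_ball.
rewrite /vol IE; split; first exact: measurable_forall_tnth.
rewrite leb_forall_tnth// (eq_bigr (fun=> (2 * e)%:E)) ?prodEFin ?prodr_const ?card_ord//.
by move=> k _; rewrite lebesgue_measure_ball ?ltW// mulr_natl.
Qed.

                                                                                          
                                                                                        
                                                                           
(** The point [p] violating the bound M has a box of violating points inside the product of the
    balls. An admissible V cannot meet this box in every factor, so some V_j misses its factor;
    symmetrizing in a direction that moves much of V_j \ B_j into B_j \ V_j raises the overlap. The
    amount depends on the box and on K but not on V. *)
Let gain : exists2 g : R, 0 < g & forall V, admissible V ->
  exists2 V', admissible V' & (overlap V + g%:E <= overlap V')%E.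
Proof.
have [e e0 [eB eM]] := box_exists.
pose k := (2 * e) ^+ n.+1; pose K' := `|K| + 1.
have k0 : 0 < k by rewrite exprn_gt0// mulr_gt0.
have K'0 : 0 < (4 * K') ^+ n.+1 by rewrite exprn_gt0// mulr_gt0// ltr_wpDl.
(* [k] bounds below the volumes of both difference sets; half of the average overlap over the cube
   of side [4 * K'] leaves a strict inequality. *)
pose g := k ^+ 2 / (4 * K') ^+ n.+1 / 2.
have g0 : 0 < g by rewrite !divr_gt0// exprn_gt0.
exists g => // V [oV VK BV VM].
have [j Vj] : exists j, V j `&` box e j = set0.
  apply: contrapT => /forallNP h.
  have /choice[x xP] j : exists x, (V j `&` box e j) x.
    by apply/set0P/eqP; exact: h.
  pose X : 'M[R]_(m, n.+1) := \matrix_(j, k) x j ord0 k.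
  have XE j : row j X = x j by apply/rowP => i; rewrite !mxE.
  have := VM X; have := eM X; rewrite ltNge => hn hy.
  apply/negP; first apply: hn => j; first by rewrite XE; have [] := xP j.
  by apply: hy => j; rewrite XE; have [] := xP j.
have /andP[rj0 rjK] := rK j.
have K0 : 0 < K by exact: lt_le_trans rjK.
have mV i := open_measurable_rowt (oV i).
pose P := @rowt R n.+1 @^-1` (V j `\` B j).
pose Q := @rowt R n.+1 @^-1` (B j `\` V j).
have mP : measurable P by exact: (measurableD (mV j) (mB j)).
have mQ : measurable Q by exact: (measurableD (mB j) (mV j)).
have kQ : (k%:E <= leb R n.+1 Q)%E.
  have [mb <-] := vol_box j e0; apply: le_measure; rewrite ?inE// => t te.
  split; first exact: eB te.
  by move=> Vt; have : (V j `&` box e j) (rowt t) by []; rewrite Vj.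
(* As V_j is at least as large as B_j, what it lacks inside B_j it has outside. *)
have QP : (leb R n.+1 Q <= leb R n.+1 P)%E.
  have := BV j; rewrite /vol (measureDI (leb R n.+1) (mB j) (mV j)).
  rewrite (measureDI (leb R n.+1) (mV j) (mB j)) setIC leeD2rE//.
  rewrite ge0_fin_numE//; apply: le_lt_trans (vol_ball0_lty n.+1 (r j)).
  by apply: le_measure; rewrite ?inE//; exact: measurableI.
have [v [v0 gv]] : exists v, tnth v ord0 != 0 :> R /\
    (g%:E < leb R n.+1 [set x | P x /\ Q (tadd x v)])%E.
  apply: contrapT => /forallNP h.
  have bnd A i t : A `<=` @Defs.ball0 R n.+1 K -> A (rowt t) -> `|tnth t i : R| <= K'.
    move=> AK /AK tK; have := coord_le_enorm (rowt t) i; rewrite mxE.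
    move=> /le_trans; apply; apply: le_trans (ltW tK) _.
    by rewrite (le_trans (ler_norm _))// lerDl.
  have : (leb R n.+1 P * leb R n.+1 Q <= (g * (4 * K') ^+ n.+1)%:E)%E.
    apply: exists_shift => //.
    - by rewrite addr_ge0.
    - exact: ltW.
    - by move=> t Pt i; apply: bnd (VK j) _; case: Pt.
    - move=> t Qt i; apply: bnd (_ : B j `<=` _) _; last by case: Qt.
      by move=> x; rewrite /Defs.ball0 /= => /lt_le_trans; apply.
    by move=> v v0; rewrite leNgt; apply/negP => gv; apply: (h v).
  apply/negP; rewrite -ltNge; apply: (@lt_le_trans _ _ (k%:E * k%:E)%E).
    by rewrite -EFinM lte_fin /g mulrAC divfK ?gt_eqF// -expr2 ltr_pdivrMr//; nra.
  by apply: lee_pmul; rewrite ?lee_fin ?(ltW k0)//; exact: le_trans QP.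
(* Dividing by the nonzero first coordinate writes v as [v0'] times a direction (1, w). *)
have [[v0' v'] vE] := tcons_eta v.
have {}v0 : v0' != 0 by move: v0; rewrite vE tcons0.
pose w := tscale (v0'^-1) v'.
have {}vE : v = tscale v0' (tcons (1 : measurableTypeR R, w)).
  rewrite vE tscale_tcons mulr1; congr (tcons (_, _)); apply: eq_from_tnth => i.
  by rewrite !tnth_mktuple mulrA mulfV// mul1r.
pose d : 'rV[R]_n.+1 := rowt (tcons (1 : measurableTypeR R, w)).
have d0 : 0 < dot d d.
  by apply: (@dot_gt0 _ _ _ ord0); rewrite mxE tcons0 /= oner_neq0.
exists (fun i => steiner d (V i)).
  split=> [i|i|i|].
  - exact: open_steiner.
  - exact: steiner_ball0.
  - by apply: le_trans (BV i) _; apply: vol_steiner (oV i) (VK i).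
  - exact: det_steiner.
(* For every index the overlap does not decrease: drop the nonnegative second term of the gain
   estimate, taken here with shift 0. *)
have other i : (vol (V i `&` B i) <= vol (steiner d (V i) `&` B i))%E.
  have /andP[ri0 _] := rK i.
  apply: le_trans (vol_steiner_gain w (oV i) (VK i) 0 ri0).
  by rewrite leeDl.
rewrite /overlap (bigD1 j)//= [leRHS](bigD1 j)//= addeAC leeD//; last first.
  by apply: lee_sum => i _; exact: other.
apply: le_trans (vol_steiner_gain w (oV j) (VK j) v0' rj0).
by rewrite leeD2l// -vE; exact: ltW.
Qed.

(** The overlap never exceeds the finite total volume of the balls, while N rounds of [gain] make it
    at least N g. *)
Lemma det_le_balls_contra V : admissible V -> False.
Proof.
move=> aV; have [g g0 gP] := gain.
have iter (N : nat) : exists2 V', admissible V' & ((N%:R * g)%:E <= overlap V')%E.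
  elim: N => [|N [V' aV' NV']].
    by exists V => //; rewrite mul0r sume_ge0.
  have [V'' aV'' h] := gP _ aV'; exists V'' => //; apply: le_trans h.
  by rewrite -natr1 mulrDl mul1r EFinD leeD2r.
pose S := (\sum_j vol (B j))%E.
have S0 : (0 <= S)%E by exact: sume_ge0.
have Sfin : S \is a fin_num.
  by apply/sum_fin_numP => j _ _; rewrite ge0_fin_numE ?vol_ball0_lty.
have [V' [oV' _ _ _]] := iter (Num.bound (fine S / g)).
apply/negP; rewrite -ltNge; apply: (@le_lt_trans _ _ S).
  apply: lee_sum => j _; apply: le_measure; rewrite ?inE//.
  by apply: measurableI; [exact: (open_measurable_rowt (oV' j))|exact: mB].
  by move=> t [].
rewrite -(fineK Sfin) lte_fin -ltr_pdivrMr//.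
by apply: archi_boundP; rewrite divr_ge0 ?(ltW g0) ?fine_ge0.
Qed.

End ball_vs_sets.

Lemma det_le_balls (R : realType) (m n : nat) (C : 'M[R]_(n.+1, m)) (M K : R)
    (r : 'I_m -> R) (V : 'I_m -> set 'rV[R]_n.+1) :
  (forall j, 0 < r j <= K) -> (forall j, open (V j)) ->
  (forall j, V j `<=` @Defs.ball0 R n.+1 K) ->
  (forall j, (vol (@Defs.ball0 R n.+1 (r j)) <= vol (V j))%E) ->
  (forall X, (forall j, V j (row j X)) -> `|\det (C *m X)| <= M) ->
  forall X, (forall j, @Defs.ball0 R n.+1 (r j) (row j X)) -> `|\det (C *m X)| <= M.
Proof.
move=> rK oV VK rV VM X XB; rewrite leNgt; apply/negP => XM.
exact: (det_le_balls_contra rK XB XM (V := V)).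
Qed.

                                                  

(** * Essential support of a set *)

Definition nearby (R : realType) n (x : 'rV[R]_n) (e : R) : set 'rV[R]_n :=
  [set y | forall i j, `|x i j - y i j| < e].

Lemma open_nearby (R : realType) n (x : 'rV[R]_n) (e : R) : open (nearby x e).
Proof.
rewrite (_ : nearby x e = obox (x - const_mx e) (x + const_mx e)).
  exact: open_obox.
apply/seteqP; split => y h i j; have := h i j; rewrite !mxE.
  by rewrite ltr_norml => /andP[? ?]; apply/andP; split; lra.
by move=> /andP[? ?]; rewrite ltr_norml; apply/andP; split; lra.
Qed.

                                                                                        
                                
(** The closed essential support, defined through outer measure: the complement of the largest open
    set meeting E in a null set. *)
Definition osupp (R : realType) n (E : set 'rV[R]_n) : set 'rV[R]_n :=
  [set x | forall e, 0 < e -> lebesgue_outer (E `&` nearby x e) != 0%E].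

Section osupp.
Context (R : realType) (n : nat) (E : set 'rV[R]_n).
Hypothesis n_gt0 : (0 < n)%N.
Local Notation lo := (@lebesgue_outer R 1 n).

Let lo0 : lo set0 = 0%E. Proof. exact: lebesgue_outer0. Qed.

Lemma lebesgue_outerU (A B : set 'rV[R]_n) : (lo (A `|` B) <= lo A + lo B)%E.
Proof.
pose F k := if k is k'.+1 then if k' is 0 then B else set0 else A.
have -> : A `|` B = \bigcup_k F k.
  apply/seteqP; split => [x [Ax|Bx]|x [[|[|k]] _ //= ?]].
  - by exists 0%N.
  - by exists 1%N.
  - by left.
  - by right.
apply: le_trans (lebesgue_outer_bigcup _) _.
rewrite (nneseries_split _ 2); last by move=> k _; exact: lebesgue_outer_ge0.
rewrite eseries0 ?adde0; last by case=> [|[|k]] //= _ _; exact: lo0.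
by rewrite !big_nat_recl// big_geq// adde0.
Qed.

Lemma outer_setD_osupp : lo (E `\` osupp E) = 0%E.
Proof.
pose G m : set 'rV[R]_n := if unpickle m is Some p then
  if lo (E `&` @rbox R n p) == 0%E then E `&` @rbox R n p else set0 else set0.
apply: (@lebesgue_outer_null_sub _ _ _ _ (\bigcup_m G m)).
  move=> x [Ex /existsNP[e /not_implyP[e0 /negP]]]; rewrite negbK => /eqP xe.
  have [p [px pe]] := near_rbox x e0.
  exists (pickle p) => //; rewrite /G pickleK ifT//.
  apply/eqP; apply: lebesgue_outer_null_sub xe => y [Ey py]; split => //.
  exact: pe.
apply: lebesgue_outer_bigcup0 => m; rewrite /G.
by case: unpickle => [p|//]; case: ifPn => [/eqP|].
Qed.

Lemma open_setC_osupp : open (~` osupp E).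
Proof.
apply/open_mxP => x /existsNP[e /not_implyP[e0 /negP]]; rewrite negbK => /eqP xe.
exists (e / 2); first exact: divr_gt0.
move=> y xy /(_ (e / 2)); rewrite divr_gt0// => /(_ isT)/negP; apply; apply/eqP.
apply: lebesgue_outer_null_sub xe => z [Ez yz]; split => // i j.
have := xy i j; have := yz i j; rewrite !ltr_norml => /andP[? ?] /andP[? ?].
by apply/andP; split; lra.
Qed.

End osupp.

Section outer_closed.
Context (R : realType) (n : nat).
Hypothesis n_gt0 : (0 < n)%N.
Local Notation lo := (@lebesgue_outer R 1 n).
Implicit Types F V : set 'rV[R]_n.

Let thicken F e : set 'rV[R]_n := \bigcup_(x in F) nearby x e.

Lemma open_thicken F e : open (thicken F e).
Proof. by apply: bigcup_open => x _; exact: open_nearby. Qed.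

Lemma closed_measurable_rowt F : open (~` F) -> measurable (@rowt R n @^-1` F).
Proof.
move=> oF; rewrite -(setCK F) preimage_setC; apply: measurableC.
exact: (open_measurable_rowt oF).
Qed.

(** F & V is the decreasing intersection of the open sets obtained by thickening F by 1/(k+1) inside
    V. Continuity from above, available since V has finite volume, transfers the bound for open
    sets. *)
Let closed_open_le_vol F V : open (~` F) -> open V -> (vol V < +oo)%E ->
  (lo (F `&` V) <= vol (F `&` V))%E.
Proof.
move=> oF oV Vfin.
have mF := closed_measurable_rowt oF; have mV := open_measurable_rowt oV.
pose O k := thicken F (1 / k.+1%:R) `&` V.
have oO k : open (O k) by apply: openI => //; exact: open_thicken.
have mO k : measurable (@rowt R n @^-1` O k) by exact: open_measurable_rowt.
have FO k : F `&` V `<=` O k.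
  move=> x [Fx Vx]; split => //; exists x => // i j.
  by rewrite subrr normr0 divr_gt0.
have capO : \bigcap_k (@rowt R n @^-1` O k) = @rowt R n @^-1` (F `&` V).
  apply/seteqP; split => [t tO|t tFV k _]; last exact: FO.
  split; last by have [] := tO 0%N Logic.I.
  apply: contrapT => nF; have /open_mxP/(_ _ nF)[e e0 eF] := oF.
  have [k ke] : exists k : nat, 1 / k.+1%:R < e.
    exists (Num.bound e^-1); rewrite ltr_pdivrMr// -ltr_pdivrMl// mulr1.
    apply: lt_trans (archi_boundP _) _; first by rewrite invr_ge0 ltW.
    by rewrite ltr_nat.
  have [[x Fx xt] _] := tO k Logic.I.
  by apply: (eF x) => // i j; rewrite distrC (lt_trans (xt i j)).
have cv : (leb R n \o (fun k => @rowt R n @^-1` O k)) @ \oo --> vol (F `&` V).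
  rewrite /vol -capO; apply: nonincreasing_cvg_mu => //.
  - apply: le_lt_trans Vfin; apply: le_measure; rewrite ?inE//.
    by move=> t [].
  - by rewrite capO; exact: measurableI.
  move=> k l kl; apply/subsetPset => t [[x Fx xt] Vt]; split => //.
  exists x => // i j; apply: lt_le_trans (xt i j) _.
  by rewrite ler_pM2l// lef_pV2 ?posrE// ler_nat.
rewrite -(cvg_lim _ cv)//; apply: lime_ge; first by apply/cvg_ex; eexists; exact: cv.
apply: nearW => k; apply: le_trans (le_lebesgue_outer (FO k)) _.
exact: outer_le_vol.
Qed.

(** Cut F into disjoint shells between balls of consecutive integer radii; each is a closed set
    intersected with a ball of finite volume. *)
Lemma closed_outer_le_vol F : open (~` F) -> (lo F <= vol F)%E.
Proof.
move=> oF; have mF := closed_measurable_rowt oF.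
pose B k := @Defs.ball0 R n k%:R.
have oB k : open (B k) by exact: open_ball0.
pose F' k := F `&` ~` B k.
have oF' k : open (~` F' k) by rewrite setCI setCK; exact: openU.
pose S k := F' k `&` B k.+1.
have mS k : measurable (@rowt R n @^-1` S k).
  by apply: measurableI; [exact: closed_measurable_rowt|exact: open_measurable_rowt].
have Bmon k l : (k <= l)%N -> B k `<=` B l.
  by move=> kl x; rewrite /B /Defs.ball0 /= => /lt_le_trans; apply; rewrite ler_nat.
have FS : F = \bigcup_k S k.
  apply/seteqP; split => [x Fx|x [k _ [[]]]//].
  have ex : exists k, `[< B k x >].
    exists (Num.bound (enorm x)); apply/asboolP.
    by apply: archi_boundP; exact: sqrtr_ge0.
  case: (ex_minnP ex) => -[|k] /asboolP Bk kmin.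
    by move: Bk; rewrite /B /Defs.ball0 /= ltNge sqrtr_ge0.
  exists k => //; split=> //; split => // /asboolP/kmin; by rewrite ltnn.
have tS : trivIset setT (fun k => @rowt R n @^-1` S k).
  apply/trivIsetP => k l _ _; apply: contra_neqP => /eqP/set0P[t [[[_ nBk] Bk] [[_ nBl] Bl]]].
  have [kl|lk|//] := ltngtP k l; exfalso.
    by apply: nBl; exact: Bmon Bk.
  by apply: nBk; exact: Bmon Bl.
rewrite [in leRHS]FS /vol preimage_bigcup measure_semi_bigcup//; last first.
  by apply: bigcup_measurable => k _; exact: mS.
rewrite [in leLHS]FS; apply: le_trans (lebesgue_outer_bigcup _) _.
apply: lee_nneseries => [k _ _|k _]; first exact: lebesgue_outer_ge0.
by apply: closed_open_le_vol => //; exact: vol_ball0_lty.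
Qed.

(** E is contained in its essential support up to a null set, so the support has volume at least the
    outer measure of E; its truncations to growing balls exhaust that volume. *)
Lemma exists_bounded_osupp (E : set 'rV[R]_n) (v : \bar R) : (v < lo E)%E ->
  exists k : nat, forall l, (k <= l)%N -> (v < vol (osupp E `&` @Defs.ball0 R n l%:R))%E.
Proof.
move=> vE; set F := osupp E.
have oF : open (~` F) by exact: open_setC_osupp.
have mF := closed_measurable_rowt oF.
pose G k := @rowt R n @^-1` (F `&` @Defs.ball0 R n k%:R).
have mG k : measurable (G k).
  by apply: measurableI => //; exact: (open_measurable_rowt (@open_ball0 R n k%:R)).
have Gmon : nondecreasing_seq G.
  move=> k l kl; apply/subsetPset => t [Ft]; rewrite /Defs.ball0 /= => tk; split => //.
  by rewrite /Defs.ball0 /=; apply: lt_le_trans tk _; rewrite ler_nat.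
have GF : \bigcup_k G k = @rowt R n @^-1` F.
  apply/seteqP; split => [t [k _ []]//|t Ft].
  exists (Num.bound (enorm (rowt t))) => //; split => //.
  by apply: archi_boundP; exact: sqrtr_ge0.
have vF : (v < vol F)%E.
  apply: lt_le_trans vE _; apply: le_trans (closed_outer_le_vol oF).
  apply: (@le_trans _ _ (lo ((E `\` F) `|` F))).
    by apply: le_lebesgue_outer => x Ex; have [|] := pselect (F x); [right|left].
  by apply: le_trans (lebesgue_outerU n_gt0 _ _) _; rewrite outer_setD_osupp// add0e.
have cv : (leb R n \o G) @ \oo --> vol F.
  rewrite /vol -GF; apply: nondecreasing_cvg_mu => //.
  by rewrite GF.
have [k vk] : exists k, (v < leb R n (G k))%E.
  apply: contrapT => /forallNP h; move: vF; apply/negP; rewrite -leNgt.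
  rewrite -(cvg_lim _ cv)//; apply: lime_le; first by apply/cvg_ex; eexists; exact: cv.
  by apply: nearW => k; rewrite leNgt; apply/negP; exact: h.
exists k => l kl; apply: lt_le_trans vk _; apply: le_measure; rewrite ?inE//.
  exact: mG.
by apply/subsetPset; exact: Gmon.
Qed.

End outer_closed.

Lemma vol_nearby_gt0 (R : realType) n (x : 'rV[R]_n) (e : R) : 0 < e -> (0 < vol (nearby x e))%E.
Proof.
move=> e0; pose I k : set (measurableTypeR R) := ball (x ord0 k) e.
have -> : vol (nearby x e) = leb R n [set t | forall k, I k (tnth t k)].
  congr (leb R n _); apply/seteqP; split => t /= h => [k|i k].
    by have := h ord0 k; rewrite !mxE.
  by have := h k; rewrite !mxE (ord1 i).
rewrite leb_forall_tnth; last by move=> k; exact: measurable_ball.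
rewrite (eq_bigr (fun=> (e *+ 2)%:E)) ?prodEFin ?lte_fin ?prodr_const ?exprn_gt0 ?mulrn_wgt0//.
by move=> k _; rewrite lebesgue_measure_ball ?ltW.
Qed.

Lemma vol_ball0_lt (R : realType) n (r s : R) : 0 <= r -> r < s ->
  (vol (@Defs.ball0 R n.+1 r) < vol (@Defs.ball0 R n.+1 s))%E.
Proof.
move=> r0 rs.
(* Strictness comes from the open cap of the larger ball beyond the hyperplane at height [r], which
   is disjoint from the smaller ball. *)
pose U : set 'rV[R]_n.+1 := [set x : 'rV[R]_n.+1 | r < x ord0 ord0] `&` @Defs.ball0 R n.+1 s.
have oU : open U.
  apply: openI; last exact: open_ball0.
  apply/open_mxP => x /= rx; exists (x ord0 ord0 - r); first by rewrite subr_gt0.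
  by move=> y /(_ ord0 ord0); rewrite ltr_norml => /andP[? ?]; lra.
pose x : 'rV[R]_n.+1 := \row_i (if i == ord0 then (r + s) / 2 else 0).
have Ux : U x.
  split; first by rewrite /= mxE eqxx; lra.
  rewrite /Defs.ball0 /= /enorm (bigD1 ord0)//= big1 ?addr0.
    by rewrite sqrtr_sqr mxE eqxx ger0_norm; lra.
  by move=> i i0; rewrite mxE (negbTE i0) expr0n.
have U0 : (0 < vol U)%E.
  have /open_mxP/(_ _ Ux)[e e0 eU] := oU.
  apply: lt_le_trans (vol_nearby_gt0 x e0) _; apply: le_measure; rewrite ?inE.
  - exact: (open_measurable_rowt (@open_nearby R n.+1 x e)).
  - exact: (open_measurable_rowt oU).
  - by move=> t xt; exact: eU.
have mr := open_measurable_rowt (@open_ball0 R n.+1 r).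
have ms := open_measurable_rowt (@open_ball0 R n.+1 s).
have mU := open_measurable_rowt oU.
apply: (@lt_le_trans _ _ (vol (@Defs.ball0 R n.+1 r) + vol U)%E).
  by rewrite lteDl// ge0_fin_numE// vol_ball0_lty.
rewrite /vol -measureU//; last first.
  apply/seteqP; split => // t [/= tr [/= rt _]]; move: tr.
  rewrite /Defs.ball0 /= ltNge => /negP; apply.
  by apply: le_trans (coord_le_enorm _ ord0); rewrite (le_trans (ltW rt))// ler_norm.
apply: le_measure; rewrite ?inE//; first exact: measurableU.
by move=> t []; [rewrite /Defs.ball0 /= => /lt_trans; exact|case].
Qed.

Lemma lebesgue_outer_setT (R : realType) n : lebesgue_outer [set: 'rV[R]_n] != 0%E.
Proof.
rewrite gt_eqF//; apply: (@lt_le_trans _ _ (vol (nearby (0 : 'rV[R]_n) 1))).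
  exact: vol_nearby_gt0.
apply: le_trans (vol_le_outer _) (le_lebesgue_outer _); last by [].
exact: (open_measurable_rowt (@open_nearby R n 0 1)).
Qed.

(** * From an almost everywhere bound on sets to a bound on balls *)

Section level_sets.
Context (R : realType) (m n : nat) (A : 'M[R]_m.+1) (C : 'M[R]_(n.+1, m.+1)).
Hypothesis A_unit : A \in unitmx.
Variables (E : 'I_m.+1 -> set 'rV[R]_n.+1) (M : R).
Hypothesis null : lebesgue_outer [set Y : 'M[R]_(m.+1, n.+1) |
  (forall j, E j (row j (A^T *m Y))) /\ M < `|\det (C *m Y)|] = 0%E.
Let C' := C *m invmx A^T.

Let AT_unit : A^T \in unitmx. Proof. by rewrite unitmx_tr. Qed.

(** A violation would persist on a neighbourhood of X. There the product of the E_j has positive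
    outer measure, yet it lies in the image under [A^T] of the null set of violations. *)
Let det_osupp (X : 'M[R]_(m.+1, n.+1)) :
  (forall j, osupp (E j) (row j X)) -> `|\det (C' *m X)| <= M.
Proof.
move=> XE; rewrite leNgt; apply/negP => MX.
have e0 : 0 < `|\det (C' *m X)| - M by rewrite subr_gt0.
have [d d0 dP] := near_lipschitz X (lipschitz_det_mulmx C') e0.
have := lebesgue_outer_rows (ltn0Sn n) (fun j => XE j d d0).
apply/negP; rewrite negbK eq_le lebesgue_outer_ge0 andbT.
rewrite -(lebesgue_outer_mulmx0 A^T (ltn0Sn m) (ltn0Sn n) null).
apply: le_lebesgue_outer => Z ZE; exists (invmx A^T *m Z); last by rewrite mulKVmx.
rewrite /= mulKVmx//; split=> [j|]; first by have [] := ZE j.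
have : `|\det (C' *m X) - \det (C' *m Z)| < `|\det (C' *m X)| - M.
  by apply: dP => j k; have [_ /(_ ord0 k)] := ZE j; rewrite !mxE.
have := ler_normD (\det (C' *m X) - \det (C' *m Z)) (\det (C' *m Z)).
by rewrite subrK mulmxA; lra.
Qed.

(** Shrinking each ball slightly around the given point makes its volume strictly smaller than the
    outer measure of E_j, which leaves room to truncate the essential support. Thickening the result
    into an open set costs an arbitrarily small d in the bound, and [det_le_balls] applies with M +
    d. *)
Lemma det_le_of_null (r : 'I_m.+1 -> R) :
  (forall j, lebesgue_outer (@Defs.ball0 R n.+1 (r j)) = lebesgue_outer (E j)) ->
  forall Y : 'M[R]_(m.+1, n.+1),
  (forall j, @Defs.ball0 R n.+1 (r j) (row j (A^T *m Y))) -> `|\det (C *m Y)| <= M.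
Proof.
move=> rE Y Yr; pose X := A^T *m Y.
have -> : C *m Y = C' *m X by rewrite /C' /X -mulmxA mulKmx.
pose s j := (enorm (row j X) + r j) / 2.
have sP j : enorm (row j X) < s j < r j.
  by have := Yr j; rewrite /Defs.ball0 /= -/X /s => ?; apply/andP; split; lra.
have s0 j : 0 < s j by have /andP[h _] := sP j; rewrite (le_lt_trans _ h)// sqrtr_ge0.
have sE j : (vol (@Defs.ball0 R n.+1 (s j)) < lebesgue_outer (E j))%E.
  have /andP[_ sr] := sP j; apply: lt_le_trans (vol_ball0_lt n (ltW (s0 j)) sr) _.
  rewrite -rE; apply: vol_le_outer.
  exact: (open_measurable_rowt (@open_ball0 R n.+1 (r j))).
have [k kP] := choice (fun j => exists_bounded_osupp (ltn0Sn n) (sE j)).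
pose k0 := \max_j k j.
pose F j := osupp (E j) `&` @Defs.ball0 R n.+1 k0%:R.
have sF j : (vol (@Defs.ball0 R n.+1 (s j)) < vol (F j))%E.
  by apply: kP; exact: leq_bigmax.
apply/ler_addgt0Pr => d d0.
have b0 : 0 <= k0%:R + 1 :> R by rewrite addr_ge0.
have [L L0 LP] := lipschitz_det_mulmx C' b0.
(* Capping at 1 keeps the thickened sets in the cube where [L] is a Lipschitz constant; the other
   term makes [L * e] at most [d]. *)
pose e := Num.min 1 (d / (L + 1)).
have e0 : 0 < e by rewrite lt_min ltr01 divr_gt0// ltr_wpDl.
pose V j := \bigcup_(x in F j) nearby x e.
have oV j : open (V j) by exact: open_thicken.
have FV j : F j `<=` V j.
  by move=> x Fx; exists x => // i l; rewrite subrr normr0.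
have Vk j x i : V j x -> `|x ord0 i| <= k0%:R + 1.
  move=> [y [_ yk] yx]; have := yx ord0 i; rewrite lt_min => /andP[h _].
  have := le_lt_trans (coord_le_enorm y i) yk => yk'.
  have -> : x ord0 i = y ord0 i - (y ord0 i - x ord0 i) by rewrite opprB addrC subrK.
  by rewrite (le_trans (ler_normB _ _))// lerD// ltW.
pose K := \sum_j s j + Num.sqrt (\sum_(i < n.+1) (k0%:R + 1) ^+ 2) + 1.
have S0 : 0 <= \sum_j s j by apply: sumr_ge0 => j _; exact: ltW.
have rK j : 0 < s j <= K.
  rewrite s0 /= /K (bigD1 j)//= -!addrA lerDl !addr_ge0 ?sqrtr_ge0//.
  by apply: sumr_ge0 => i _; exact: ltW.
apply: (det_le_balls (r := s) (V := V) rK) => //.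
- move=> j x Vx; rewrite /Defs.ball0 /=.
  apply: (@le_lt_trans _ _ (Num.sqrt (\sum_(i < n.+1) (k0%:R + 1) ^+ 2))); last first.
    by rewrite /K; lra.
  apply: ler_wsqrtr; apply: ler_sum => i _.
  by rewrite -(real_normK (num_real _)) ler_sqr ?nnegrE// (Vk j).
- move=> j; apply/ltW; apply: lt_le_trans (sF j) _; apply: le_measure; rewrite ?inE.
  + apply: measurableI; last exact: (open_measurable_rowt (@open_ball0 R n.+1 k0%:R)).
    by apply: closed_measurable_rowt; exact: open_setC_osupp.
  + exact: (open_measurable_rowt (oV j)).
  + by move=> t; exact: FV.
- move=> Z ZV.
  have /choice[x xP] j : exists x, F j x /\ nearby x e (row j Z).
    by have [x ? ?] := ZV j; exists x.
  have xF j : F j (x j) by have [] := xP j.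
  have xZ j : nearby (x j) e (row j Z) by have [] := xP j.
  pose W : 'M[R]_(m.+1, n.+1) := \matrix_(j, i) x j ord0 i.
  have WE j : row j W = x j by apply/rowP => i; rewrite !mxE.
  have WM : `|\det (C' *m W)| <= M.
    by apply: det_osupp => j; rewrite WE; have [] := xF j.
  have : `|\det (C' *m W) - \det (C' *m Z)| <= L * e.
    apply: LP => [|j i|j i|j i]; first exact: ltW.
    - by rewrite mxE; apply: Vk; exact: FV.
    - by have := Vk j (row j Z) i (ZV j); rewrite mxE.
    - by have := xZ j ord0 i; rewrite !mxE => /ltW.
  have : e * (L + 1) <= d by rewrite -ler_pdivlMr ?ltr_wpDl// ge_min lexx orbT.
  have := ler_normD (\det (C' *m Z) - \det (C' *m W)) (\det (C' *m W)).
  rewrite subrK distrC mulrDr mulr1 mulrC => h1 h2 h3; lra.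
- by move=> j; have /andP[] := sP j.
Qed.

End level_sets.

(** * Rearrangements through level sets, and the essential suprema *)

(** If no level s >= t contributed, the integrand would be at most the indicator of [0, t], and the
    integral at most t. *)
Lemma lt_sym_rearr (R : realType) n (f : 'rV[R]_n -> R) (x : 'rV[R]_n) (t : R) :
  0 <= t -> (t%:E < sym_rearr f x)%E ->
  exists2 s, t <= s & sym_set (suplevel f s) x.
Proof.
move=> t0 tx; apply: contrapT => h; move: tx; apply/negP; rewrite -leNgt.
have {}h s : t <= s -> ~ sym_set (suplevel f s) x by move=> ts fs; apply: h; exists s.
apply: (@le_trans _ _ (\int[@lebesgue_measure R]_s
   (\1_(`[0%R, t]%classic : set (measurableTypeR R)) s)%:E)%E); last first.
  by rewrite integral_indic// setIT -[t in leRHS]subr0 -lebesgue_measure_itvcc.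
rewrite /sym_rearr integral_mkcond !ge0_integralTE//; last first.
  by move=> s; rewrite patchE; case: ifP.
(* The comparison is made on the simple functions below the integrand, in the supremum defining the
   integral. *)
apply: ereal_sup_le => _ [g gf <-]; exists g => // s.
apply: le_trans (gf s) _; rewrite patchE.
case: ifPn => [|_]; last by rewrite lee_fin.
rewrite inE /= in_itv /= andbT => s0; rewrite !indicE lee_fin.
have [st|ts] := leP s t.
  have -> : s \in (`[0%R, t]%classic : set (measurableTypeR R)).
    by apply/mem_set; rewrite /= in_itv /= s0 st.
  by case: (_ \in _).
by rewrite memNset// ; exact: h (ltW ts).
Qed.

(** Multiplication by b is continuous from below in a, including infinite values: b infinite
    contradicts the bound at one t, and a infinite forces b = 0. *)
Lemma mule_le_of_lt (R : realType) (a b : \bar R) (c : R) :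
  (0 < a)%E -> (0 <= b)%E ->
  (forall t : R, 0 < t -> (t%:E < a)%E -> (t%:E * b <= c%:E)%E) -> (a * b <= c%:E)%E.
Proof.
move=> a0 b0 H.
have [t t0 ta] : exists2 t : R, 0 < t & (t%:E < a)%E.
  case: a a0 {H} => [a| |] //; last by exists 1 => //; rewrite ltry.
  by rewrite lte_fin => a0; exists (a / 2); [lra|rewrite lte_fin; lra].
case: b b0 H => [b| |] // b0 H; last first.
  by have := H t t0 ta; rewrite gt0_muley ?lte_fin.
rewrite lee_fin in b0; case: a a0 ta H => [a| |] // a0 ta H.
  rewrite lte_fin in a0; rewrite -EFinM lee_fin leNgt; apply/negP => cab.
  have bgt0 : 0 < b.
    rewrite lt_neqAle b0 andbT; apply: contraTneq cab => <-.
    by have := H t t0 ta; rewrite -EFinM lee_fin -leNgt => ?; nra.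
  have c0 : 0 <= c.
    by have := H t t0 ta; rewrite -EFinM lee_fin; apply: le_trans; rewrite mulr_ge0 ?ltW.
  have ca : c / b < a by rewrite ltr_pdivrMr.
  have cb0 : 0 <= c / b by rewrite divr_ge0.
  have := H ((c / b + a) / 2); rewrite -EFinM lee_fin lte_fin.
  have : c / b * b = c by rewrite divfK ?gt_eqF.
  by move=> cb /(_ ltac:(lra) ltac:(lra)); nra.
have b_eq0 : b = 0.
  apply/eqP; rewrite eq_le b0 andbT leNgt; apply/negP => bgt0.
  have := H ((`|c| + 1) / b); rewrite -EFinM divfK ?gt_eqF// lee_fin ltry.
  have h : 0 < `|c| + 1 by rewrite ltr_wpDl.
  move=> /(_ (divr_gt0 h bgt0) isT); have := ler_norm c; lra.
by rewrite b_eq0 mule0; have := H t t0 ta; rewrite b_eq0 mule0.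
Qed.

Lemma prode_le_of_lt (R : realType) m (a : 'I_m -> \bar R) (d c : R) : 0 <= d ->
  (forall j, 0 < a j)%E ->
  (forall t : 'I_m -> R, (forall j, 0 < t j) -> (forall j, (t j)%:E < a j)%E ->
     (\prod_j t j) * d <= c) ->
  ((\prod_j a j) * d%:E <= c%:E)%E.
Proof.
elim: m a d => [|m IH] a d d0 a0 H.
  rewrite big_ord0 mul1e lee_fin; have := H (fun=> 0); rewrite big_ord0 mul1r.
  by apply => -[].
rewrite big_ord_recl -muleA; apply: mule_le_of_lt => //.
  by rewrite mule_ge0 ?lee_fin// prode_ge0// => j _; exact: ltW.
move=> t t0 ta; rewrite muleC -muleA -EFinM.
apply: IH => // [|s s0 sa]; first by rewrite mulr_ge0// ltW.
pose u j := if unlift ord0 j is Some k then s k else t.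
have u0 : u ord0 = t by rewrite /u unlift_none.
have uS k : u (lift ord0 k) = s k by rewrite /u liftK.
have := H u; rewrite big_ord_recl u0 (eq_bigr s) => [|k _]; last exact: uS.
rewrite -mulrA mulrCA (mulrC t) => h; apply: h => j.
  by case: (unliftP ord0 j) => [k ->|->]; rewrite ?uS ?u0.
by case: (unliftP ord0 j) => [k ->|->]; rewrite ?uS ?u0.
Qed.

Lemma sum_scale_rowE (R : realType) m n (A : 'M[R]_m) (Y : 'M[R]_(m, n)) j :
  \sum_(i < m) A i j *: row i Y = row j (A^T *m Y).
Proof.
by apply/rowP => k; rewrite summxE !mxE; apply: eq_bigr => i _; rewrite !mxE.
Qed.

(** Any c admissible in the infimum on the right is a pointwise upper bound on the left, so its
    exceptional set there is empty. By [prode_le_of_lt] it is enough to test real numbers below the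
    values of the rearrangements, and these are dominated by levels s_j to which [det_le_of_null]
    applies. *)
Lemma ess_sup_sym_rearr (R : realType) m n (A : 'M[R]_m.+1) (C : 'M[R]_(n.+1, m.+1))
    (f : 'I_m.+1 -> 'rV[R]_n.+1 -> R) : A \in unitmx -> (forall j x, 0 <= f j x) ->
  (lebesgue_ess_sup (fun Y : 'M[R]_(m.+1, n.+1) =>
     (\prod_j sym_rearr (f j) (\sum_i A i j *: row i Y)) * (`|\det (C *m Y)|)%:E)
   <= lebesgue_ess_sup (fun Y : 'M[R]_(m.+1, n.+1) =>
     (\prod_j (f j (\sum_i A i j *: row i Y))%:E) * (`|\det (C *m Y)|)%:E))%E.
Proof.
move=> Au f0; apply: ereal_inf_le_tmp => c /= cN.
suff le_c Y : (\prod_j sym_rearr (f j) (\sum_i A i j *: row i Y) * (`|\det (C *m Y)|)%:E <= c)%E.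
  rewrite (_ : [set _ | _] = set0) ?lebesgue_outer0//.
  by apply/seteqP; split => // Y /=; rewrite ltNge le_c.
(* A negative [c] would make the whole space null, since the product is nonnegative. *)
have c_ge0 : (0 <= c)%E.
  rewrite leNgt; apply/negP => c0.
  have := lebesgue_outer_rows (ltn0Sn n) (fun _ : 'I_m.+1 => lebesgue_outer_setT R n.+1).
  apply/negP; rewrite negbK -cN; apply/eqP; congr lebesgue_outer.
  apply/seteqP; split => // Z _ /=; apply: lt_le_trans c0 _.
  by rewrite mule_ge0 ?lee_fin// prode_ge0// => j _; rewrite lee_fin.
case: c cN c_ge0 => [c| |] cN c0; [|by rewrite leey|by []].
rewrite lee_fin in c0; set d := `|\det (C *m Y)|.
have d0 : 0 <= d by exact: normr_ge0.
have s0 j x : (0 <= sym_rearr (f j) x)%E by apply: integral_ge0 => s _; rewrite lee_fin.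
have [s_gt0|] := pselect (forall j, 0 < sym_rearr (f j) (\sum_i A i j *: row i Y))%E; last first.
  move=> /existsNP[j /negP]; rewrite -leNgt => sj.
  have sj0 : sym_rearr (f j) (\sum_i A i j *: row i Y) = 0%E.
    by apply/eqP; rewrite eq_le sj s0.
  by rewrite (bigD1 j)//= sj0 mul0e mul0e lee_fin.
apply: prode_le_of_lt => // t t0 tlt.
have /choice[s sP] j : exists s, t j <= s /\
    sym_set (suplevel (f j) s) (\sum_i A i j *: row i Y).
  by have [s ? ?] := lt_sym_rearr (ltW (t0 j)) (tlt j); exists s.
have ss0 j : 0 < s j by have [ts _] := sP j; exact: lt_le_trans ts.
have S0 : 0 < \prod_j s j by apply: prodr_gt0.
have /choice[r rP] j := (sP j).2.
apply: (@le_trans _ _ (\prod_j s j * d)).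
  by rewrite ler_wpM2r//; apply: ler_prod => j _; rewrite ltW//=; have [] := sP j.
rewrite mulrC -ler_pdivlMr//.
(* The bound is M = c / prod s_j: where all f_j exceed s_j and the determinant exceeds M, the
   product exceeds [c], which happens only on a null set. *)
apply: (@det_le_of_null _ _ _ A C Au (fun j => suplevel (f j) (s j)) _ _ r).
- apply: lebesgue_outer_null_sub cN => Z [/= ZE ZM].
  apply: (@lt_le_trans _ _ ((\prod_j s j)%:E * (`|\det (C *m Z)|)%:E)%E).
    by rewrite -EFinM lte_fin mulrC -ltr_pdivrMr.
  rewrite prodEFin -!EFinM lee_fin ler_wpM2r//; apply: ler_prod => j _.
  by rewrite (ltW (ss0 j)) sum_scale_rowE ltW//; exact: ZE.
- by move=> j; have [] := rP j.
- by move=> j; rewrite -sum_scale_rowE; have [_] := rP j.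
Qed.

(** * Dimension zero and conclusion *)

(** Every box has volume 1 as an empty product, and covers are infinite sequences, so no set is
    null, not even the empty one, and the infimum runs over the empty set. The case n = 0 of the
    theorem follows. *)
Lemma ess_sup_dim0 (R : realType) p (F : 'M[R]_(p, 0) -> \bar R) :
  lebesgue_ess_sup F = +oo%E.
Proof.
apply/eqP; rewrite -leye_eq; apply: le_ereal_inf_tmp => c /= c0.
suff : (1 <= lebesgue_outer [set y | c < F y])%E by rewrite c0 lee_fin ler10.
apply: le_ereal_inf_tmp => _ [a [b [ab _ ->]]].
have vE k : mvol (a k) (b k) = 1 by apply: big1 => i _; rewrite big_ord0.
under eq_eseriesr do rewrite vE.
by rewrite nneseries_recl// leeDl// nneseries_ge0.
Qed.

Unset Implicit Arguments.

Theorem theorem2p5 (R : realType) (n : nat) :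
  (forall (A : 'M[R]_n), A \in unitmx ->
   forall f : 'I_n -> 'rV[R]_n -> R,
   (forall j x, 0 <= f j x) ->
   (forall j, lmeasurable_fun (f j)) ->
   (forall j, vanishes_at_infinity (f j)) ->
   (lebesgue_ess_sup (fun y : 'M[R]_(n, n) =>
      (\prod_(j < n) sym_rearr (f j) (\sum_(i < n) A i j *: row i y)
       * (det_origin y)%:E)%E)
    <= lebesgue_ess_sup (fun y : 'M[R]_(n, n) =>
      (\prod_(j < n) (f j (\sum_(i < n) A i j *: row i y))%:E
       * (det_origin y)%:E)%E))%E)
  /\
  (forall (A : 'M[R]_(n.+1)), A \in unitmx ->
   forall f : 'I_n.+1 -> 'rV[R]_n -> R,
   (forall j x, 0 <= f j x) ->
   (forall j, lmeasurable_fun (f j)) ->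
   (forall j, vanishes_at_infinity (f j)) ->
   (lebesgue_ess_sup (fun y : 'M[R]_(n.+1, n) =>
      (\prod_(j < n.+1) sym_rearr (f j) (\sum_(i < n.+1) A i j *: row i y)
       * (det_aff y)%:E)%E)
    <= lebesgue_ess_sup (fun y : 'M[R]_(n.+1, n) =>
      (\prod_(j < n.+1) (f j (\sum_(i < n.+1) A i j *: row i y))%:E
       * (det_aff y)%:E)%E))%E).
Proof.
case: n => [|n]; first by split=> A _ f _ _ _; rewrite [leRHS]ess_sup_dim0 leey.
split=> A Au f f0 _ _.
  have dE (y : 'M[R]_n.+1) : det_origin y = `|\det (1%:M *m y)| by rewrite mul1mx.
  under [X in (lebesgue_ess_sup X <= _)%E]eq_fun do rewrite dE.
  under [X in (_ <= lebesgue_ess_sup X)%E]eq_fun do rewrite dE.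
  exact: ess_sup_sym_rearr.
(* Row i of [C *m y] is row i of [y] minus its last row, which turns [det_aff] into the determinant
   form treated above. *)
pose C : 'M[R]_(n.+1, n.+2) :=
  \matrix_(i, k) ((k == widen_ord (leqnSn n.+1) i)%:R - (k == ord_max)%:R).
have dE (y : 'M[R]_(n.+2, n.+1)) : det_aff y = `|\det (C *m y)|.
  congr `|\det _|; apply/matrixP => i k; rewrite !mxE.
  under eq_bigr do rewrite mxE mulrBl.
  rewrite sumrB; congr (_ - _).
    rewrite (bigD1 (widen_ord (leqnSn n.+1) i))//= eqxx mul1r big1 ?addr0//.
    by move=> l /negbTE ->; rewrite mul0r.
  rewrite (bigD1 ord_max)//= eqxx mul1r big1 ?addr0//.
  by move=> l /negbTE ->; rewrite mul0r.
under [X in (lebesgue_ess_sup X <= _)%E]eq_fun do rewrite dE.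
under [X in (_ <= lebesgue_ess_sup X)%E]eq_fun do rewrite dE.
exact: ess_sup_sym_rearr.
Qed.
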